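(* Let $p,q\in(0,1)$, $L=1$, $R\ge2$, and assume $\alpha(p,q,R,1)=1/2$; thus $p=p_0=\frac{1-2q+q^{R+1}}{1-2q+q^R}$. Let $(X_n)_{n\ge0}$ be the site-based feedback random walk with parameters $p,q,R,L=1$ and initial environment $\omega$. In the case of negative feedback, $p<q$, assume also that $\omega$ is constant in a neighborhood of $-\infty$. (i) If $\omega(x)=(q,0)$ in a neighborhood of $+\infty$, then $(X_n)$ is $\mathbb{P}_\omega$-a.s. recurrent. (ii) If $\omega(x)=(q,i)$ in a neighborhood of $+\infty$, for some $1\le i\le R-1$, then $(X_n)$ is $\mathbb{P}_\omega$-a.s. recurrent if $P_{R,i}(q)\ge0$, and $\mathbb{P}_\omega$-a.s. transient to $+\infty$ if $P_{R,i}(q)<0$, where $$P_{R,i}(q)=(2R-1)q^{R+2}-(3R+1)q^{R+1}+(R+1)q^R-2q^{R+2-i}+3q^{R+1-i}-q^{R-i}+(1-2q)^2.$$ (iii) If $\omega(x)=(p,0)$ in a neighborhood of $+\infty$, then $(X_n)$ is $\mathbb{P}_\omega$-a.s. recurrent if $P_{R,R}(q)\ge0$, and $\mathbb{P}_\omega$-a.s. transient to $+\infty$ if $P_{R,R}(q)<0$, where $$P_{R,R}(q)=(2R-1)q^{R+2}-(3R+1)q^{R+1}+(R+1)q^R+2q^2-q.$$ Moreover, for each $R\ge2$ there exists a unique root $q_*(R)\in(0,1/2)$ of the polynomial $P_{R,R}(q)$; for $q\in(0,1)$ one has $P_{R,R}(q)>0$ if $q>q_*(R)$ and $P_{R,R}(q)<0$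 if $q<q_*(R)$; and $\lim_{R\to\infty}q_*(R)=1/2$.
   Context: Model (site-based feedback random walk). Fix $p,q\in(0,1)$ and $R,L\in\mathbb{N}=\{1,2,\dots\}$. The set of single site configurations is $\Lambda=\Lambda_p\cup\Lambda_q$, where $\Lambda_p=\{(p,0),\dots,(p,L-1)\}$ and $\Lambda_q=\{(q,0),\dots,(q,R-1)\}$ (formal labels, $\Lambda_p$ and $\Lambda_q$ being regarded as disjoint). An environment is an element $\omega=\{\omega(x)\}_{x\in\mathbb{Z}}\in\Lambda^{\mathbb{Z}}$. The pair $(X_n,\omega_n)_{n\ge0}$ is a Markov process with $X_n\in\mathbb{Z}$, $\omega_n\in\Lambda^{\mathbb{Z}}$ and $\omega_0=\omega$ (the initial environment). Jump rule: if $\omega_n(X_n)\in\Lambda_p$ then $X_{n+1}=X_n+1$ with probability $p$ and $X_{n+1}=X_n-1$ with probability $1-p$; if $\omega_n(X_n)\in\Lambda_q$ then $X_{n+1}=X_n+1$ with probability $q$ and $X_{n+1}=X_n-1$ with probability $1-q$. Environment update: $\omega_{n+1}(x)=\omega_n(x)$ for all $x\ne X_n$, and at the site $X_n$: - if $\omega_n(X_n)\in\Lambda_p\cup\{(q,R-1)\}$ and $X_{n+1}=X_n+1$, then $\omega_{n+1}(X_n)=(p,0)$; - if $\omega_n(X_n)=(q,i)$, $0\le i\le R-2$, and $X_{n+1}=X_n+1$, then $\omega_{n+1}(X_n)=(q,i+1)$; - if $\omega_n(X_n)\in\Lambda_q\cup\{(p,L-1)\}$ and $X_{n+1}=X_n-1$,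 then $\omega_{n+1}(X_n)=(q,0)$; - if $\omega_n(X_n)=(p,i)$, $0\le i\le L-2$, and $X_{n+1}=X_n-1$, then $\omega_{n+1}(X_n)=(p,i+1)$. $\mathbb{P}_{\omega}$ is the law of the process with initial environment $\omega$ and $X_0=0$. The path $(X_n)$ is recurrent if $N_0=|\{n\ge0:X_n=0\}|=\infty$, and transient to $+\infty$ if $\lim_{n\to\infty}X_n=+\infty$. A property holds in a neighborhood of $+\infty$ (of $-\infty$) if it holds for all sufficiently large $x$ (all sufficiently negative $x$). The quantity $\alpha$ is $$\alpha(p,q,R,L)=\frac{p\cdot\big[(1-q)q^R(1-(1-p)^L)\big]+q\cdot\big[p(1-p)^L(1-q^R)\big]}{\big[(1-q)q^R(1-(1-p)^L)\big]+\big[p(1-p)^L(1-q^R)\big]}.$$ *)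

(* Defs.v *)
From HB Require Import structures.
From mathcomp Require Import all_boot all_order all_algebra.
From mathcomp Require Import all_classical all_reals all_analysis.
From mathcomp Require Import ring.

Set Implicit Arguments.
Unset Strict Implicit.
Unset Printing Implicit Defensive.

Import Order.TTheory GRing.Theory Num.Theory.
Import numFieldNormedType.Exports.

Local Open Scope classical_set_scope.
Local Open Scope ring_scope.

(* [Lp i] and [Lq i] are the formal labels (p,i) and (q,i); they are distinct
   constructors, so the two families stay disjoint even when p = q. *)
Inductive label := Lp of nat | Lq of nat.

Definition Lambda (R L : nat) : set label :=
  [set s | match s with Lp i => (i < L)%N | Lq i => (i < R)%N end].

Definition env := int -> label.

Definition label_right (R : nat) (s : label) : label :=
  match s with
  | Lp _ => Lp 0
  | Lq i => if (i.+1 < R)%N then Lq i.+1 else Lp 0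
  end.

Definition label_left (L : nat) (s : label) : label :=
  match s with
  | Lp i => if (i.+1 < L)%N then Lp i.+1 else Lq 0
  | Lq _ => Lq 0
  end.

Definition env_set (e : env) (x : int) (s : label) : env :=
  fun y => if y == x then s else e y.

Definition state : Type := (int * env)%type.

Definition step_right (R : nat) (s : state) : state :=
  (s.1 + 1, env_set s.2 s.1 (label_right R (s.2 s.1))).

Definition step_left (L : nat) (s : state) : state :=
  (s.1 - 1, env_set s.2 s.1 (label_left L (s.2 s.1))).

Definition prob_right (K : realType) (p q : K) (s : state) : K :=
  match s.2 s.1 with Lp _ => p | Lq _ => q end.

(* [S n] is the pair (X_n, omega_n). Measurability is with respect to the
   product of the discrete sigma-algebras on Z x Lambda^Z. Started from
   (0, w), the process visits almost surely only the countably many states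
   reachable from (0, w), so its law is determined by the elementary
   probabilities of finite histories. Quantifying over all realizations [S]
   amounts to speaking about the law P_w. *)
Record feedback_walk (K : realType) (d : measure_display)
    (T : measurableType d) (P : probability T K) (p q : K) (R L : nat)
    (w : env) (S : nat -> T -> state) : Prop := FeedbackWalk {
  walk_pos_measurable : forall n x, measurable [set t | (S n t).1 = x];
  walk_env_measurable : forall n x s, measurable [set t | (S n t).2 x = s];
  walk_init : P [set t | S 0%N t = (0, w)] = 1%E;
  walk_right : forall n (h : nat -> state),
    P [set t | (forall k, (k <= n)%N -> S k t = h k) /\
               S n.+1 t = step_right R (h n)] =
    (P [set t | forall k, (k <= n)%N -> S k t = h k] *
     (prob_right p q (h n))%:E)%E;
  walk_left : forall n (h : nat -> state),
    P [set t | (forall k, (k <= n)%N -> S k t = h k) /\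
               S n.+1 t = step_left L (h n)] =
    (P [set t | forall k, (k <= n)%N -> S k t = h k] *
     (1 - prob_right p q (h n))%:E)%E }.

Definition recurrent_path (x : nat -> int) : Prop :=
  infinite_set [set n | x n = 0].

Definition transient_pinfty_path (K : realType) (x : nat -> int) : Prop :=
  ((x n)%:~R : K) @[n --> \oo] --> +oo.

Definition as_recurrent (K : realType) (d : measure_display)
    (T : measurableType d) (P : probability T K) (S : nat -> T -> state) :=
  {ae P, forall t, recurrent_path (fun n => (S n t).1)}.

Definition as_transient_pinfty (K : realType) (d : measure_display)
    (T : measurableType d) (P : probability T K) (S : nat -> T -> state) :=
  {ae P, forall t, transient_pinfty_path K (fun n => (S n t).1)}.

Definition near_pinfty (Q : int -> Prop) : Prop :=
  exists N : int, forall x, N <= x -> Q x.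

Definition near_ninfty (Q : int -> Prop) : Prop :=
  exists N : int, forall x, x <= N -> Q x.

Definition alpha (K : realType) (p q : K) (R L : nat) : K :=
  let a := (1 - q) * q ^+ R * (1 - (1 - p) ^+ L) in
  let b := p * (1 - p) ^+ L * (1 - q ^+ R) in
  (p * a + q * b) / (a + b).

(* The natural-number subtractions in the exponents are exact for i <= R. *)
Definition Ppoly (K : realType) (R i : nat) : {poly K} :=
  (2 * R%:R - 1) *: 'X^(R + 2) - (3 * R%:R + 1) *: 'X^(R + 1)
  + (R%:R + 1) *: 'X^R
  - 2 *: 'X^(R + 2 - i) + 3 *: 'X^(R + 1 - i) - 'X^(R - i)
  + (1 - 2 *: 'X) ^+ 2.

Definition PpolyRR (K : realType) (R : nat) : {poly K} :=
  (2 * R%:R - 1) *: 'X^(R + 2) - (3 * R%:R + 1) *: 'X^(R + 1)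
  + (R%:R + 1) *: 'X^R + 2 *: 'X^2 - 'X.

Lemma Ppoly_diag (K : realType) (R : nat) : Ppoly K R R = PpolyRR K R.
Proof.
rewrite /Ppoly /PpolyRR !addKn subnn expr1 expr0 !scaler_nat.
set A := _ - _ + _ *: 'X^R; ring.
Qed.

(* Main.v *)
Require Import Defs.
From HB Require Import structures.
From mathcomp Require Import all_boot all_order all_algebra.
From mathcomp Require Import all_classical all_reals all_analysis.
From mathcomp Require Import ring lra zify.

(* Because L = 1, every left jump resets its site to (q,0), so the numbers of
   right jumps made by a site between its successive left jumps are independent
   and, apart from the first one, equidistributed with a generating function g;
   the first one has generating function [gam j], with j read off the initial
   label. The condition alpha = 1/2 says g'(1) = 1, so jumps across consecutive
   edges form a critical branching process whose first individual is atypical.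

   Put t_k = g^k(0). The probability of going down N levels before going up one
   is the product over j < N of gam(t_j) (one factor per site). Since
   sum (1 - t_j) diverges it tends to 0 for every environment, so limsup X = +oo
   almost surely.

   To the right, with a_k = prod_(j < k) gam J (t_j) / g(t_j), the sum of the
   a_k (1 - t_k^z) is harmonic for the branching process. Writing it as a
   function of the position and the environment gives an explicit martingale of
   the walk, bounded iff sum a_k converges, and comparing a_k with 1 - t_k shows
   that this happens iff (gam J)'(1) > 1 + g''(1) / 2. Finally
   P_{R,i}(q) = q^R (1 - q)^2 (1 + g''(1) / 2 - (gam (R - i))'(1)). *)

Import Order.TTheory GRing.Theory Num.Theory.
Import numFieldNormedType.Exports.

Local Open Scope classical_set_scope.
Local Open Scope ring_scope.

Set Implicit Arguments.
Unset Strict Implicit.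
Unset Printing Implicit Defensive.

(** * Generating functions *)

(** The quotient in a_k corrects for the atypical first individual. If z > 0 jumps cross an edge and
    Z jumps cross the next one, then E t_k^Z = gam J (t_k) g(t_k)^(z-1), which equals (a_(k+1) /
    a_k) t_(k+1)^z. Averaging therefore shifts k by one, and no term is lost at k = 0 because t_0 =
    0. The series may diverge, so it is cut at n; each new maximum then causes an error of at most
    a_n. For recurrence the sign of this error is favourable. For transience the walk is watched for
    m steps only, and n is chosen after m so that m a_n is small. Hitting estimates are inequalities
    between functions of the state, proved by induction on the number of steps; a realization enters
    only at the end, through the probabilities of its finite histories. As the environment near the
    origin is arbitrary, recurrence at 0 combines certain return to a far site with a positive
    chance of a run of left jumps from there. *)

Section GeneratingFunctions.
Variables (K : realType) (p q : K).

(* Generating function of the number of right jumps before the next left jump of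
   a site labelled (q, R - j), or (p, 0) when j = 0. *)
Fixpoint gam (j : nat) (t : K) : K :=
  if j is i.+1 then 1 - q + q * t * gam i t else (1 - p) / (1 - p * t).

(* [gam_mean j] and [gam_curv j 1] are (gam j)'(1) and (gam j)''(1) / 2. *)
Fixpoint gam_slope (j : nat) (t : K) : K :=
  if j is i.+1 then q * (1 + t * gam_slope i t) else p / (1 - p * t).

Fixpoint gam_mean (j : nat) : K :=
  if j is i.+1 then q * (1 + gam_mean i) else p / (1 - p).

Fixpoint gam_curv (j : nat) (t : K) : K :=
  if j is i.+1 then q * (gam_mean i + t * gam_curv i t)
  else p ^+ 2 / ((1 - p) * (1 - p * t)).

Fixpoint gam_third (j : nat) (t : K) : K :=
  if j is i.+1 then q * (gam_curv i 1 + t * gam_third i t)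
  else p ^+ 3 / ((1 - p) ^+ 2 * (1 - p * t)).

Hypotheses (hp : 0 < p < 1) (hq : 0 < q < 1).

Let denom_gt0 (t : K) : t <= 1 -> 0 < 1 - p * t.
Proof.
have [p0 p1] := andP hp; have [q0 q1] := andP hq.
move=> ht; have h : p * t <= p by rewrite ler_piMr // ltW.
lra.
Qed.

(** [gam_slope], [gam_curv] and [gam_third] are the successive divided differences of [gam j] at 1.
    They give Taylor expansions at 1 with exact remainder, without any derivative. *)
Lemma gamE (j : nat) (t : K) : t <= 1 ->
  gam j t = 1 - (1 - t) * gam_slope j t.
Proof.
move=> ht; have d := denom_gt0 ht.
elim: j => [|j IH] /=; last by rewrite IH; ring.
by field; rewrite gt_eqF.
Qed.

Lemma gam_slopeE (j : nat) (t : K) : t <= 1 ->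
  gam_slope j t = gam_mean j - (1 - t) * gam_curv j t.
Proof.
have [p0 p1] := andP hp; have [q0 q1] := andP hq.
move=> ht; have d := denom_gt0 ht.
elim: j => [|j IH] /=; last by rewrite IH; ring.
by field; rewrite !gt_eqF //; lra.
Qed.

Lemma gam_curvE (j : nat) (t : K) : t <= 1 ->
  gam_curv j t = gam_curv j 1 - (1 - t) * gam_third j t.
Proof.
have [p0 p1] := andP hp; have [q0 q1] := andP hq.
move=> ht; have d := denom_gt0 ht.
elim: j => [|j IH] /=; last by rewrite IH; ring.
by field; rewrite ?mulr1 !gt_eqF //; lra.
Qed.

Lemma gam_mean_gt0 (j : nat) : 0 < gam_mean j.
Proof.
have [p0 p1] := andP hp; have [q0 q1] := andP hq.
elim: j => [|j IH] /=; first by apply: divr_gt0; lra.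
by apply: mulr_gt0; lra.
Qed.

Lemma gam_mean_le (R j : nat) : (j <= R)%N -> gam_mean j <= gam_mean 0 + R%:R.
Proof.
have [p0 p1] := andP hp; have [q0 q1] := andP hq.
move=> jR; apply: (@le_trans _ _ (gam_mean 0 + j%:R)); last by rewrite lerD2l ler_nat.
elim: j {jR} => [|j IH]; first by rewrite addr0.
have := gam_mean_gt0 j; rewrite -natr1; move: IH => /=; nra.
Qed.

Lemma gam_curv_gt0 (j : nat) (t : K) : 0 <= t <= 1 -> 0 < gam_curv j t.
Proof.
have [p0 p1] := andP hp; have [q0 q1] := andP hq.
move=> /andP[t0 t1]; have d := denom_gt0 t1.
elim: j => [|j IH] /=.
  by apply: divr_gt0; [rewrite exprn_gt0 //; lra | apply: mulr_gt0 => //; lra].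
by have := gam_mean_gt0 j; move=> m0; apply: mulr_gt0; [lra | nra].
Qed.

Lemma gam_third_ge0 (j : nat) (t : K) : 0 <= t <= 1 -> 0 <= gam_third j t.
Proof.
have [p0 p1] := andP hp; have [q0 q1] := andP hq.
move=> /andP[t0 t1]; have d := denom_gt0 t1.
elim: j => [|j IH] /=.
  by apply: divr_ge0; [rewrite exprn_ge0 //; lra | apply: mulr_ge0; [rewrite exprn_ge0|]; lra].
have c0 : 0 <= gam_curv j 1 by apply/ltW/gam_curv_gt0; rewrite ler01 lexx.
by apply: mulr_ge0; [lra | apply: addr_ge0 => //; apply: mulr_ge0].
Qed.

Lemma gam_third_le (j : nat) (t : K) : 0 <= t <= 1 -> gam_third j t <= gam_third j 1.
Proof.
have [p0 p1] := andP hp; have [q0 q1] := andP hq.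
move=> /andP[t0 t1]; have d := denom_gt0 t1.
elim: j => [|j IH] /=.
  apply: ler_wpM2l; first by rewrite exprn_ge0 //; lra.
  rewrite lef_pV2 ?posrE ?mulr_gt0 ?exprn_gt0 //; try lra.
  by apply: ler_wpM2l; [rewrite exprn_ge0|]; nra.
apply: ler_wpM2l; first lra.
rewrite lerD2l mul1r; apply: (@le_trans _ _ (gam_third j t)) => //.
by apply: ler_piMl => //; apply: gam_third_ge0; rewrite t0.
Qed.

(** The base case is at least p and every later one at least q; the product bounds all labels at
    once. *)
Lemma gam_slope_ge (j : nat) (t : K) : 0 <= t <= 1 -> p * q <= gam_slope j t.
Proof.
have [p0 p1] := andP hp; have [q0 q1] := andP hq.
move=> /andP[t0 t1]; have d := denom_gt0 t1.
suff : p * q <= gam_slope j t /\ 0 <= gam_slope j t by case.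
elim: j => [|j [_ IH]] /=.
  2: by have ts0 : 0 <= t * gam_slope j t by [rewrite mulr_ge0]; split; nra.
have pt0 : 0 <= p * t by rewrite mulr_ge0 // ltW.
have h : p <= p / (1 - p * t) by rewrite ler_pdivlMr //; nra.
by split; nra.
Qed.

Lemma gam_ge (j : nat) (t : K) : 0 <= t <= 1 -> (1 - p) * (1 - q) <= gam j t.
Proof.
have [p0 p1] := andP hp; have [q0 q1] := andP hq.
move=> /andP[t0 t1]; have d := denom_gt0 t1.
elim: j => [|j IH] /=; last first.
  have h : 0 <= gam j t by apply: le_trans IH; nra.
  have h2 : 0 <= q * t * gam j t by rewrite !mulr_ge0 // ltW.
  nra.
have pt0 : 0 <= p * t by rewrite mulr_ge0 // ltW.
by apply: (@le_trans _ _ (1 - p)); [nra | rewrite ler_pdivlMr //; nra].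
Qed.

Lemma gam_gt0 (j : nat) (t : K) : 0 <= t <= 1 -> 0 < gam j t.
Proof.
have [p0 p1] := andP hp; have [q0 q1] := andP hq.
by move=> /(gam_ge j); apply: lt_le_trans; nra.
Qed.

Lemma gam_le (j : nat) (t : K) : 0 <= t <= 1 -> gam j t <= 1 - p * q * (1 - t).
Proof.
move=> ht; have := gam_slope_ge j ht; rewrite gamE; last lra.
by move=> h; nra.
Qed.

Lemma gam_lower (j : nat) (t : K) : 0 <= t <= 1 -> 1 - gam_mean j * (1 - t) <= gam j t.
Proof.
move=> ht; rewrite gamE ?gam_slopeE; try lra.
have h : 0 <= (1 - t) ^+ 2 * gam_curv j t.
  by rewrite mulr_ge0 ?sqr_ge0 // ltW // gam_curv_gt0.
nra.
Qed.

End GeneratingFunctions.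

(** * Iteration of a critical generating function *)

Section Products.
Variable K : realType.

(** By (1 - x)(1 + s + x) <= 1 + s. It turns a divergent sum into a vanishing product. *)
Lemma prodr_1B_le (x : nat -> K) (n : nat) : (forall i, 0 <= x i <= 1) ->
  \prod_(i < n) (1 - x i) <= (1 + \sum_(i < n) x i)^-1.
Proof.
move=> hx; elim: n => [|n IH]; first by rewrite !big_ord0 addr0 invr1.
rewrite !big_ord_recr /=; have /andP[x0 x1] := hx n.
have s0 : 0 <= \sum_(i < n) x i by apply: sumr_ge0 => i _; have /andP[] := hx i.
set s := \sum_(i < n) x i in IH s0 *.
apply: (@le_trans _ _ ((1 + s)^-1 * (1 - x n))).
  by apply: ler_wpM2r => //; lra.
rewrite -[leRHS]mul1r ler_pdivlMr; last lra.
rewrite mulrAC -mulrA mulrC ler_pdivrMr; nra.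
Qed.

Lemma prodr_1B_ge (x : nat -> K) (n : nat) : (forall i, 0 <= x i <= 1) ->
  1 - \sum_(i < n) x i <= \prod_(i < n) (1 - x i) <= 1.
Proof.
move=> hx; elim: n => [|n /andP[IH IH1]]; first by rewrite !big_ord0 subr0 lexx.
rewrite !big_ord_recr /=; have /andP[x0 x1] := hx n.
have s0 : 0 <= \sum_(i < n) x i by apply: sumr_ge0 => i _; have /andP[] := hx i.
have P0 : 0 <= \prod_(i < n) (1 - x i).
  by apply: prodr_ge0 => i _; rewrite subr_ge0; have /andP[] := hx i.
set s := \sum_(i < n) x i in IH s0 *; set P := \prod_(i < n) (1 - x i) in IH IH1 P0 *.
by apply/andP; split; nra.
Qed.

Lemma prodr_1D_le_expR (x : nat -> K) (n : nat) : (forall i, 0 <= x i) ->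
  \prod_(i < n) (1 + x i) <= expR (\sum_(i < n) x i).
Proof.
move=> hx; elim: n => [|n IH]; first by rewrite !big_ord0 expR0.
rewrite !big_ord_recr /= expRD; apply: ler_pM => //.
- by apply: prodr_ge0 => i _; rewrite addr_ge0.
- by rewrite addr_ge0.
- exact: expR_ge1Dx.
Qed.

End Products.

(* [e] is the distance to 1 of the iterates of a critical generating function. *)
Section CriticalIteration.
Variables (K : realType) (e S : nat -> K) (s c r : K).
Hypotheses (s_gt0 : 0 < s) (r_gt0 : 0 < r).
Hypotheses (e0 : e 0%N = 1) (eS : forall n, e n.+1 = e n - e n ^+ 2 * S n).
Hypotheses (e_gt0 : forall n, 0 < e n) (hS : forall n, s <= S n <= c).
Hypothesis (hr : forall n, r * e n <= e n.+1).

Lemma crit_nonincr (m n : nat) : (m <= n)%N -> e n <= e m.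
Proof.
elim: n => [|n IH]; first by rewrite leqn0 => /eqP ->.
rewrite leq_eqVlt ltnS => /orP[/eqP-> //|/IH h]; apply: le_trans h.
rewrite eS; have /andP[S0 _] := hS n.
have : 0 <= e n ^+ 2 * S n by rewrite mulr_ge0 ?sqr_ge0 //; have := s_gt0; lra.
lra.
Qed.

Lemma crit_sum_sqr (n : nat) : s * \sum_(k < n) e k ^+ 2 <= 1 - e n.
Proof.
elim: n => [|n IH]; first by rewrite big_ord0 mulr0 e0 subrr.
rewrite big_ord_recr /= mulrDr eS; have /andP[S0 _] := hS n.
have h : e n ^+ 2 * s <= e n ^+ 2 * S n by rewrite ler_wpM2l // sqr_ge0.
nra.
Qed.

Lemma crit_small (d : K) : 0 < d -> exists n, forall k, (n <= k)%N -> e k <= d.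
Proof.
move=> d0; apply: contrapT => /forallNP h.
have hd n : d < e n.
  have /existsNP[k /not_implyP[nk /negP]] := h n.
  by rewrite -ltNge => /lt_le_trans; apply; exact: crit_nonincr.
pose n := (Num.truncn (1 / (s * d ^+ 2))).+1.
have hn : 1 / (s * d ^+ 2) < n%:R by exact: truncnS_gt.
have sd0 : 0 < s * d ^+ 2 by rewrite mulr_gt0 // exprn_gt0.
move: hn; rewrite ltr_pdivrMr // => hn.
have : s * (n%:R * d ^+ 2) <= s * \sum_(k < n) e k ^+ 2.
  rewrite ler_pM2l // mulr_natl -[X in _ *+ X](card_ord n) -sumr_const.
  by apply: ler_sum => i _; rewrite ler_sqr ?nnegrE ltW // (lt_trans d0).
have := crit_sum_sqr n; have := e_gt0 n; nra.
Qed.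

(** Since e_n / e_(n+1) <= 1 + (c / r) e_n, a bounded sum would bound 1 / e_n by an exponential, so
    the e_n would stay away from 0 and their sum would diverge. *)
Lemma crit_sum_unbounded (B : K) : exists n, B <= \sum_(k < n) e k.
Proof.
apply: contrapT => /forallNP h.
have {}h n : \sum_(k < n) e k <= B by have /negP := h n; rewrite -ltNge => /ltW.
have c0 : 0 < c by have /andP[] := hS 0%N; have := s_gt0; lra.
have cr0 : 0 < c / r by rewrite divr_gt0.
have lower n : (e n)^-1 <= expR (c / r * B).
  apply: (@le_trans _ _ (expR (\sum_(k < n) c / r * e k))); last first.
    by rewrite ler_expR -mulr_sumr ler_pM2l.
  apply: le_trans (@prodr_1D_le_expR _ (fun k => c / r * e k) n _); last first.
    by move=> k; rewrite mulr_ge0 // ltW.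
  elim: n => [|n IH]; first by rewrite big_ord0 e0 invr1.
  rewrite big_ord_recr /=; apply: le_trans (ler_wpM2r _ IH); last first.
    by rewrite addr_ge0 // mulr_ge0 // ltW.
  have := e_gt0 n; have := e_gt0 n.+1; have := hr n; have /andP[_ Sc] := hS n.
  have r0 := r_gt0; have En := eS n.
  set x := e n; set y := e n.+1 => h1 y0 x0.
  rewrite ler_pdivlMl // ler_pdivrMr //.
  have h2 : c * x ^+ 2 <= c / r * x * y.
    have -> : c * x ^+ 2 = c / r * x * (r * x) by field; rewrite gt_eqF.
    by rewrite ler_wpM2l // mulr_ge0 // ltW.
  have h3 : x ^+ 2 * S n <= x ^+ 2 * c by rewrite ler_wpM2l // sqr_ge0.
  have -> : (1 + c / r * x) * y = y + c / r * x * y by ring.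
  rewrite {1}/y En -/x; lra.
have E0 : 0 < expR (c / r * B) by exact: expR_gt0.
set E := expR _ in lower E0.
pose n := (Num.truncn (B * E)).+1.
have hn : B * E < n%:R by exact: truncnS_gt.
have : n%:R * E^-1 <= \sum_(k < n) e k.
  rewrite mulr_natl -[X in _ *+ X](card_ord n) -sumr_const.
  by apply: ler_sum => i _; rewrite -[leRHS]invrK lef_pV2 ?posrE ?invr_gt0.
move=> /le_trans/(_ (h n)); rewrite ler_pdivrMr //; lra.
Qed.

Lemma crit_tail_unbounded (m : nat) (B : K) :
  exists L0, forall L, (L0 <= L)%N -> forall k, (k <= m)%N -> B <= \sum_(i < L) e (k + i).
Proof.
have [n hn] := crit_sum_unbounded (B + \sum_(k < m) e k).
exists n => L nL k km.
apply: (@le_trans _ _ (\sum_(i < L) e (m + i))); last first.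
  by apply: ler_sum => i _; apply: crit_nonincr; rewrite leq_add2r.
have : \sum_(k < n) e k <= \sum_(k < m + L) e k.
  rewrite -(subnKC (leq_trans nL (leq_addl m L))) big_split_ord /= lerDl.
  by apply: sumr_ge0 => i _; exact: ltW.
rewrite big_split_ord /=; lra.
Qed.

End CriticalIteration.

(** * Convergence of the sum of the weights *)

Section Weights.
Variables (K : realType) (p q : K) (R J : nat).

(* The t_k and, below, the a_k of the header. *)
Definition gam_iter (k : nat) : K := iter k (gam p q R) 0.

Definition weight (k : nat) : K :=
  \prod_(j < k) (gam p q J (gam_iter j) / gam p q R (gam_iter j)).

Hypotheses (hp : 0 < p < 1) (hq : 0 < q < 1) (hR : (0 < R)%N).
Hypothesis (hcrit : gam_mean p q R = 1).

(** The probability that the critical branching process started from one individual is alive in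
    generation k. *)
Let surv k := 1 - gam_iter k.
Let c := gam_curv p q R 1.
Let s := q * gam_mean p q R.-1.

Lemma gam_iter_itv (k : nat) : 0 <= gam_iter k < 1.
Proof.
have [p0 p1] := andP hp; have [q0 q1] := andP hq.
elim: k => [|k /andP[IH0 IH1]]; first by rewrite /gam_iter /= lexx ltr01.
rewrite /gam_iter iterS -/(gam_iter k).
have h : 0 <= gam_iter k <= 1 by rewrite IH0 ltW.
rewrite ltW ?gam_gt0 //=; have := gam_le hp hq R h.
have : 0 < p * q * (1 - gam_iter k) by rewrite !mulr_gt0 // subr_gt0.
lra.
Qed.

Lemma gam_iter_itvW (k : nat) : 0 <= gam_iter k <= 1.
Proof. by have /andP[-> /ltW] := gam_iter_itv k. Qed.

Let gam_iter_le1 k : gam_iter k <= 1.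
Proof. by have /andP[] := gam_iter_itvW k. Qed.

Let surv0 : surv 0 = 1.
Proof. by rewrite /surv /gam_iter /= subr0. Qed.

Let survS n : surv n.+1 = surv n - surv n ^+ 2 * gam_curv p q R (gam_iter n).
Proof.
rewrite /surv [gam_iter n.+1]iterS -/(gam_iter n) gamE // gam_slopeE // hcrit; ring.
Qed.

Let surv_gt0 n : 0 < surv n.
Proof. by have /andP[_] := gam_iter_itv n; rewrite subr_gt0. Qed.

Let s_gt0 : 0 < s.
Proof. by have [q0 _] := andP hq; rewrite mulr_gt0 // gam_mean_gt0. Qed.

Let curv_itv n : s <= gam_curv p q R (gam_iter n) <= c.
Proof.
have [q0 q1] := andP hq.
apply/andP; split.
  rewrite /s; move: hR; case: (R) => //= m _; rewrite ler_pM2l // lerDl.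
  have /andP[t0 _] := gam_iter_itvW n.
  by rewrite mulr_ge0 // ltW // gam_curv_gt0 // gam_iter_itvW.
rewrite gam_curvE // gerBl mulr_ge0 ?gam_third_ge0 ?gam_iter_itvW //.
exact/ltW/surv_gt0.
Qed.

Let pq_gt0 : 0 < p * q.
Proof. by have [p0 _] := andP hp; have [q0 _] := andP hq; rewrite mulr_gt0. Qed.

Let surv_ratio n : p * q * surv n <= surv n.+1.
Proof.
rewrite /surv [gam_iter n.+1]iterS -/(gam_iter n) gamE // subKr mulrC ler_wpM2l //.
  exact/ltW/surv_gt0.
exact/gam_slope_ge/gam_iter_itvW.
Qed.

Lemma gam_iter_nondecr (m n : nat) : (m <= n)%N -> 1 - gam_iter n <= 1 - gam_iter m.
Proof. exact: (crit_nonincr s_gt0 survS curv_itv). Qed.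

Lemma gam_iter_cvg1 (d : K) : 0 < d -> exists n, forall k, (n <= k)%N -> 1 - gam_iter k <= d.
Proof. exact: (crit_small s_gt0 surv0 survS surv_gt0 curv_itv). Qed.

Lemma gam_iter_tail_unbounded (m : nat) (B : K) :
  exists L0, forall L, (L0 <= L)%N -> forall k, (k <= m)%N ->
    B <= \sum_(i < L) (1 - gam_iter (k + i)).
Proof.
exact: (crit_tail_unbounded s_gt0 pq_gt0 surv0 survS surv_gt0 curv_itv surv_ratio).
Qed.

Let gam_ext_gt0 j k : 0 < gam p q j (gam_iter k).
Proof. exact/gam_gt0/gam_iter_itvW. Qed.

Lemma weight0 : weight 0 = 1.
Proof. by rewrite /weight big_ord0. Qed.

Lemma weight_gt0 (k : nat) : 0 < weight k.
Proof. by apply: prodr_gt0 => i _; rewrite divr_gt0. Qed.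

(** The denominator of the new factor is g(t_k) = t_(k+1). This is the shift of index behind
    [potential_max]. *)
Lemma weightS (k : nat) : weight k.+1 * gam_iter k.+1 = weight k * gam p q J (gam_iter k).
Proof.
rewrite [gam_iter k.+1]iterS -/(gam_iter k) /weight big_ord_recr -mulrA divfK //.
by rewrite gt_eqF.
Qed.

Let weight_ratio k : weight k.+1 / surv k.+1 =
  weight k / surv k * (gam p q J (gam_iter k) /
    (gam p q R (gam_iter k) * (1 - surv k * gam_curv p q R (gam_iter k)))).
Proof.
have e0 := surv_gt0 k; have e1 := surv_gt0 k.+1; have g0 := gam_ext_gt0 R k.
have h : surv k.+1 = surv k * (1 - surv k * gam_curv p q R (gam_iter k)).
  by rewrite survS; ring.
have h0 : 0 < 1 - surv k * gam_curv p q R (gam_iter k).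
  by move: e1; rewrite h pmulr_rgt0.
rewrite {1}/weight big_ord_recr /= -/(weight k) h; field.
by rewrite !gt_eqF.
Qed.

Let e_le1 k : surv k <= 1.
Proof. by rewrite /surv gerBl; have /andP[] := gam_iter_itvW k. Qed.

(* (a_k+1 / a_k) / ((1 - t_k+1) / (1 - t_k)) >= 1 / (1 + C (1 - t_k)^2), and the
   (1 - t_k)^2 are summable while the 1 - t_k are not. *)
Lemma weight_sum_unbounded (B : K) : gam_mean p q J <= 1 + c ->
  exists n, B <= \sum_(k < n) weight k.
Proof.
move=> hJ; have [p0 p1] := andP hp; have [q0 q1] := andP hq.
set d := gam_third p q R 1.
have d0 : 0 <= d by rewrite gam_third_ge0 // ler01 lexx.
have c0 : 0 < c by rewrite gam_curv_gt0 // ler01 lexx.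
set gm := (1 - p) * (1 - q); have gm0 : 0 < gm by rewrite mulr_gt0 // subr_gt0.
(* 2 c + d is the coefficient of x^2 in (1 - x + c x^2)(1 - x (c - x d)), and c d absorbs the term
   in x^4. Division by [gm], a lower bound of [gam J], lets the correction multiply [gam J]. *)
set C := (2 * c + d + c * d) / gm.
have C0 : 0 <= C by rewrite divr_ge0 ?ltW // ; nra.
have step k : weight k / surv k <= weight k.+1 / surv k.+1 * (1 + C * surv k ^+ 2).
  rewrite weight_ratio -mulrA ler_peMr //.
    by rewrite divr_ge0 // ltW // ?weight_gt0.
  have x0 := surv_gt0 k; have x1 := e_le1 k.
  have g0 := gam_ext_gt0 R k; have j0 := gam_ext_gt0 J k.
  have /andP[S0 S1] := curv_itv k.
  have Sd : c - surv k * d <= gam_curv p q R (gam_iter k).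
    rewrite gam_curvE // lerD2l lerN2; apply: ler_wpM2l; first exact: ltW.
    exact: gam_third_le (gam_iter_itvW k).
  have gR : gam p q R (gam_iter k) = 1 - surv k + surv k ^+ 2 * gam_curv p q R (gam_iter k).
    by rewrite gamE // gam_slopeE // hcrit /surv; ring.
  have lowJ : 1 - (1 + c) * surv k <= gam p q J (gam_iter k).
    apply: le_trans (gam_lower hp hq J (gam_iter_itvW k)).
    by rewrite lerD2l lerN2 ler_wpM2r // ltW.
  have lowJ' : gm <= gam p q J (gam_iter k) by exact/gam_ge/gam_iter_itvW.
  have h0 : 0 < 1 - surv k * gam_curv p q R (gam_iter k).
    have := surv_gt0 k.+1; rewrite survS => h.
    rewrite -(pmulr_rgt0 _ x0); move: h; congr (_ < _); ring.
  rewrite mulrAC ler_pdivlMr; last by rewrite mulr_gt0.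
  rewrite mul1r gR.
  move: x0 x1 S0 S1 Sd lowJ lowJ' h0 j0 s_gt0 {gR g0}.
  move: (surv k) (gam_curv p q R (gam_iter k)) (gam p q J (gam_iter k)) => x S G.
  move=> x0 x1 S0 S1 Sd lowJ lowJ' h0 G0 s0.
  have hC : (2 * c + d + c * d) * x ^+ 2 <= G * (C * x ^+ 2).
    rewrite mulrA ler_wpM2r ?sqr_ge0 // -[leLHS](divfK (lt0r_neq0 gm0)) -/C mulrC.
    by rewrite ler_wpM2r.
  have h1 : (1 - x + x ^+ 2 * S) * (1 - x * S)
     <= (1 - x + x ^+ 2 * c) * (1 - x * (c - x * d)).
    have x20 : 0 <= x ^+ 2 := sqr_ge0 x.
    apply: ler_pM; [nra | exact: ltW | | nra].
    by rewrite lerD2l ler_wpM2l.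
  apply: (le_trans h1).
  have -> : (1 - x + x ^+ 2 * c) * (1 - x * (c - x * d)) =
    1 - (1 + c) * x + (2 * c + d + c * d) * x ^+ 2
    - (c * d * x ^+ 2 * (1 - x ^+ 2) + x ^+ 3 * (d + c ^+ 2)) by ring.
  have x3 : 0 <= x ^+ 3 * (d + c ^+ 2).
    by rewrite mulr_ge0 ?exprn_ge0 ?addr_ge0 ?sqr_ge0 // ltW.
  have x4 : 0 <= c * d * x ^+ 2 * (1 - x ^+ 2).
    by rewrite mulr_ge0 ?mulr_ge0 ?sqr_ge0 ?(ltW c0) //; nra.
  rewrite mulrDr mulr1; lra.
have lower n : 1 <= weight n / surv n * expR (C / s).
  apply: (@le_trans _ _ (weight n / surv n * \prod_(k < n) (1 + C * surv k ^+ 2))).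
    elim: n => [|n IH]; first by rewrite big_ord0 weight0 surv0 divr1 mulr1.
    apply: (le_trans IH); rewrite big_ord_recr /=.
    rewrite [leRHS](_ : _ = weight n.+1 / surv n.+1 * (1 + C * surv n ^+ 2)
       * \prod_(k < n) (1 + C * surv k ^+ 2)); last by ring.
    apply: ler_wpM2r; last exact: step.
    by apply: prodr_ge0 => i _; rewrite addr_ge0 // mulr_ge0 // sqr_ge0.
  rewrite ler_wpM2l //; first by rewrite divr_ge0 ?ltW ?weight_gt0.
  apply: le_trans (@prodr_1D_le_expR _ (fun k => C * surv k ^+ 2) n _) _.
    by move=> k; rewrite mulr_ge0 // sqr_ge0.
  rewrite ler_expR -mulr_sumr ler_wpM2l // -[leRHS]div1r ler_pdivlMr // mulrC.
  apply: le_trans (crit_sum_sqr surv0 survS curv_itv n) _.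
  by rewrite gerBl ltW.
set E := expR (C / s) in lower; have E0 : 0 < E by exact: expR_gt0.
have [n hn] := crit_sum_unbounded s_gt0 pq_gt0 surv0 survS surv_gt0 curv_itv surv_ratio (B * E).
exists n; rewrite -(ler_pM2r E0); apply: (le_trans hn); rewrite mulr_suml.
apply: ler_sum => k _; have := lower k.
by rewrite mulrAC ler_pdivlMr // mul1r.
Qed.

(* Here the same double ratio is at most 1 - d (1 - t_k) for large k, which makes
   d a_k smaller than a telescoping difference. *)
Lemma weight_sum_bounded : 1 + c < gam_mean p q J ->
  exists2 B, 0 < B & forall n, \sum_(k < n) weight k <= B.
Proof.
move=> hJ; have [p0 p1] := andP hp; have [q0 q1] := andP hq.
(* Half of the excess pays for the second-order term of [gam J] once [surv k] is at most [d / cJ];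
   the other half is the gain. *)
set d := (gam_mean p q J - 1 - c) / 2; have d0 : 0 < d by rewrite /d; lra.
set cJ := gam_curv p q J 1.
have cJ0 : 0 < cJ by rewrite gam_curv_gt0 // ler01 lexx.
have [n0 small] : exists n, forall k, (n <= k)%N -> surv k <= d / cJ.
  by apply: gam_iter_cvg1; rewrite divr_gt0.
have step k : (n0 <= k)%N ->
    d * weight k <= weight k / surv k - weight k.+1 / surv k.+1.
  move=> /small hk; rewrite weight_ratio.
  have x0 := surv_gt0 k; have x1 := e_le1 k; have w0 := weight_gt0 k.
  have g0 := gam_ext_gt0 R k; have j0 := gam_ext_gt0 J k.
  have /andP[S0 S1] := curv_itv k.
  have gR : gam p q R (gam_iter k) = 1 - surv k + surv k ^+ 2 * gam_curv p q R (gam_iter k).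
    by rewrite gamE // gam_slopeE // hcrit /surv; ring.
  have upJ : gam p q J (gam_iter k) <= 1 - (1 + c + d) * surv k.
    rewrite gamE // gam_slopeE // gam_curvE // -/cJ.
    have h3 : 0 <= gam_third p q J (gam_iter k) by rewrite gam_third_ge0 // gam_iter_itvW.
    rewrite -/(surv k); move: hk; rewrite ler_pdivlMr // => hk.
    have h4 : 0 <= surv k ^+ 3 * gam_third p q J (gam_iter k).
      by rewrite mulr_ge0 // exprn_ge0 // ltW.
    have h5 : surv k * (surv k * cJ) <= surv k * d by rewrite ler_pM2l.
    have -> : gam_mean p q J = 1 + c + 2 * d by rewrite /d; field.
    nra.
  have h0 : 0 < 1 - surv k * gam_curv p q R (gam_iter k).
    have := surv_gt0 k.+1; rewrite survS => h.
    rewrite -(pmulr_rgt0 _ x0); move: h; congr (_ < _); ring.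
  have key : gam p q J (gam_iter k) / (gam p q R (gam_iter k) *
      (1 - surv k * gam_curv p q R (gam_iter k))) <= 1 - d * surv k.
    rewrite ler_pdivrMr ?mulr_gt0 // gR; apply: (le_trans upJ).
    move: x0 x1 S0 S1 h0 s_gt0 j0 upJ {gR g0 hk}.
    move: (surv k) (gam_curv p q R (gam_iter k)) (gam p q J (gam_iter k)) => x S G.
    move=> x0 x1 S0 S1 h0 s0 G0 upJ.
    have cS : x * S <= x * c by rewrite ler_wpM2l // ltW.
    have c0 : 0 < c by lra.
    have l1 : 0 < 1 - (1 + c + d) * x by lra.
    have dx : 0 < 1 - d * x by nra.
    apply: (@le_trans _ _ ((1 - d * x) * ((1 - x) * (1 - x * c)))).
      have -> : (1 - d * x) * ((1 - x) * (1 - x * c)) = 1 - (1 + c + d) * x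
        + x ^+ 2 * (c * (1 - d * x) + d * (1 + c)) + 0 by ring.
      rewrite addr0 lerDl mulr_ge0 ?sqr_ge0 // addr_ge0 // mulr_ge0 // ?ltW //.
      lra.
    apply: ler_wpM2l; first exact: ltW.
    apply: ltW.
    apply: (@le_lt_trans _ _ ((1 - x) * (1 - x * S))).
      by rewrite ler_wpM2l //; lra.
    rewrite ltr_pM2r //; have : 0 < x ^+ 2 * S by rewrite mulr_gt0 ?exprn_gt0 //; lra.
    lra.
  have ws : 0 <= weight k / surv k by rewrite divr_ge0 ?ltW.
  have := ler_wpM2l ws key; rewrite [leRHS]mulrBr mulr1.
  have -> : weight k / surv k * (d * surv k) = d * weight k.
    by field; rewrite gt_eqF.
  lra.
have tele m : d * \sum_(k < m) weight (n0 + k) <=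
    weight n0 / surv n0 - weight (n0 + m) / surv (n0 + m).
  elim: m => [|m IH]; first by rewrite big_ord0 mulr0 addn0 subrr.
  rewrite big_ord_recr /= mulrDr addnS; have := step (n0 + m)%N (leq_addr _ _); lra.
have bnd m : \sum_(k < m) weight (n0 + k) <= weight n0 / surv n0 / d.
  rewrite ler_pdivlMr // mulrC; apply: (le_trans (tele m)).
  by rewrite gerBl divr_ge0 ?ltW ?weight_gt0.
exists (\sum_(k < n0) weight k + weight n0 / surv n0 / d) => [|n].
  apply: ltr_wpDl; last by apply: divr_gt0 => //; apply: divr_gt0 => //; exact: weight_gt0.
  by apply: sumr_ge0 => i _; exact/ltW/weight_gt0.
apply: (@le_trans _ _ (\sum_(k < n0 + n) weight k)).
  rewrite addnC big_split_ord /= lerDl.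
  by apply: sumr_ge0 => i _; exact/ltW/weight_gt0.
by rewrite big_split_ord /= lerD2l; exact: bnd.
Qed.

End Weights.

(** * Hitting times of the walk *)

Section Chain.
Variables (K : realType) (p q : K) (R : nat).

Definition mean_step (f : state -> K) (s : state) : K :=
  prob_right p q s * f (step_right R s) +
  (1 - prob_right p q s) * f (step_left 1 s).

(** The probability that the positions at times 0 to n miss A, as a function of the state alone;
    [prob_off] relates it to realizations of the walk. *)
Fixpoint avoid (A : pred int) (n : nat) (s : state) : K :=
  if A s.1 then 0 else if n is m.+1 then mean_step (avoid A m) s else 1.

Definition never (A : pred int) (s : state) : K := limn (fun n => avoid A n s).

Hypotheses (hp : 0 < p < 1) (hq : 0 < q < 1).

Let delta := (1 - p) * (1 - q).

Let delta_itv : 0 < delta < 1.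
Proof.
have [p0 p1] := andP hp; have [q0 q1] := andP hq.
by apply/andP; split; rewrite /delta; nra.
Qed.

Let prob_left_ge s : delta <= 1 - prob_right p q s.
Proof.
have [p0 p1] := andP hp; have [q0 q1] := andP hq.
by rewrite /delta /prob_right; case: (s.2 s.1) => _; nra.
Qed.

Lemma prob_right_itv s : 0 < prob_right p q s < 1.
Proof. by rewrite /prob_right; case: (s.2 s.1). Qed.

Lemma mean_stepD f g s :
  mean_step (fun s => f s + g s) s = mean_step f s + mean_step g s.
Proof. by rewrite /mean_step; ring. Qed.

Lemma mean_step_cst a s : mean_step (fun=> a) s = a.
Proof. by rewrite /mean_step; ring. Qed.

Lemma mean_step_le_at f g s : f (step_right R s) <= g (step_right R s) ->
  f (step_left 1 s) <= g (step_left 1 s) -> mean_step f s <= mean_step g s.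
Proof.
have /andP[r0 r1] := prob_right_itv s.
move=> h1 h2; rewrite /mean_step.
by apply: lerD; apply: ler_wpM2l => //; [exact: ltW | rewrite subr_ge0 ltW].
Qed.

Lemma mean_step_le f g s : (forall s, f s <= g s) -> mean_step f s <= mean_step g s.
Proof. by move=> fg; exact: mean_step_le_at. Qed.

Section Avoid.
Variable A : pred int.

Lemma avoid_itv n s : 0 <= avoid A n s <= 1.
Proof.
elim: n s => [|n IH] s /=; case: ifP => _; rewrite ?lexx ?ler01 //.
apply/andP; split.
  by rewrite -(mean_step_cst 0 s); apply: mean_step_le => t; have /andP[] := IH t.
by rewrite -(mean_step_cst 1 s); apply: mean_step_le => t; have /andP[] := IH t.
Qed.

Lemma avoid_in n s : A s.1 -> avoid A n s = 0.
Proof. by case: n => [|n] /= ->. Qed.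

Lemma avoidS_le n s : avoid A n.+1 s <= avoid A n s.
Proof.
elim: n s => [|n IH] s.
  case E: (A s.1); first by rewrite !avoid_in.
  by rewrite {2}/avoid E; have /andP[] := avoid_itv 1 s.
case E: (A s.1); first by rewrite !avoid_in.
by rewrite [leRHS]/= [leLHS]/= E; apply: mean_step_le.
Qed.

Lemma avoid_nonincr s : {homo (fun n => avoid A n s) : m n / (m <= n)%N >-> n <= m}.
Proof. by apply/nonincreasing_seqP => n; exact: avoidS_le. Qed.

Lemma avoid_cvg s : avoid A n s @[n --> \oo] --> never A s.
Proof.
apply: nonincreasing_is_cvgn; first exact: avoid_nonincr.
by exists 0 => _ [n _ <-]; have /andP[] := avoid_itv n s.
Qed.

Lemma never_le_avoid n s : never A s <= avoid A n s.
Proof.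
apply: nonincreasing_cvgn_ge; first exact: avoid_nonincr.
exact: avoid_cvg.
Qed.

Lemma never_ge a s : (forall n, a <= avoid A n s) -> a <= never A s.
Proof.
by move=> h; apply: limr_ge; [exact: avoid_cvg | apply: nearW].
Qed.

Lemma never_itv s : 0 <= never A s <= 1.
Proof.
apply/andP; split; first by apply: never_ge => n; have /andP[] := avoid_itv n s.
by apply: le_trans (never_le_avoid 0 s) _; have /andP[] := avoid_itv 0 s.
Qed.

Lemma never_in s : A s.1 -> never A s = 0.
Proof.
move=> As; apply/eqP; rewrite eq_le; have /andP[-> _] := never_itv s.
by rewrite andbT; apply: le_trans (never_le_avoid 0 s) _; rewrite avoid_in.
Qed.

(** An inequality, so as to hold also on A, where the left side is 0. *)
Lemma never_le_mean_step s : never A s <= mean_step (never A) s.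
Proof.
have h : mean_step (avoid A n) s @[n --> \oo] --> mean_step (never A) s.
  by apply: cvgD; apply: cvgMr; exact: avoid_cvg.
rewrite -(cvg_lim (@Rhausdorff K) h); apply: limr_ge; first by apply/cvg_ex; eexists; exact: h.
apply: nearW => n; apply: le_trans (never_le_avoid n.+1 s) _ => /=; case: ifP => // _.
rewrite -(mean_step_cst 0 s); apply: mean_step_le => t.
by have /andP[] := avoid_itv n t.
Qed.

End Avoid.

Lemma never_le_add (A B : pred int) (M c : K) s :
  (forall n, never B s <= M + c * avoid A n s) -> never B s <= M + c * never A s.
Proof.
move=> h.
have cv : M + c * avoid A n s @[n --> \oo] --> M + c * never A s.
  by apply: cvgD; [exact: cvg_cst | apply: cvgMr; exact: avoid_cvg].
rewrite -(cvg_lim (@Rhausdorff K) cv); apply: limr_ge; last exact: nearW.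
by apply/cvg_ex; eexists; exact: cv.
Qed.

(** The strong Markov property at the hitting time of A; the invariant I is needed only up to that
    time. *)
Lemma never_trans (I : state -> Prop) (A B : pred int) (M : K) :
  (forall s, I s -> ~~ A s.1 -> I (step_right R s) /\ I (step_left 1 s)) ->
  0 <= M -> (forall s, I s -> A s.1 -> never B s <= M) ->
  forall s, I s -> never B s <= M + never A s.
Proof.
move=> Istep M0 hA s Is; rewrite -[never A s]mul1r; apply: never_le_add => n; rewrite mul1r.
elim: n s Is => [|n IH] s Is /=; case: ifPn => As.
- by rewrite addr0; exact: hA.
- by have /andP[_ h] := never_itv B s; rewrite ler_wpDl.
- by rewrite addr0; exact: hA.
have [IR IL] := Istep s Is As.
apply: le_trans (never_le_mean_step B s) _.
rewrite -[X in X + _](mean_step_cst M s) -mean_stepD.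
by apply: mean_step_le_at; exact: IH.
Qed.

(* The value of the supermartingale is a relation [Q] rather than a function of
   the state because it will depend on the running maximum of the walk. *)
Lemma never_supermartingale (Q : state -> K -> Prop) (A B : pred int) :
  (forall s v, Q s v -> 0 <= v) ->
  (forall s v, Q s v -> B s.1 -> 1 <= v) ->
  (forall s v, Q s v -> ~~ A s.1 -> ~~ B s.1 ->
    exists v1 v2, [/\ Q (step_right R s) v1, Q (step_left 1 s) v2 &
      prob_right p q s * v1 + (1 - prob_right p q s) * v2 <= v]) ->
  forall s v, Q s v -> never A s <= v + never (predU A B) s.
Proof.
move=> Q0 QB Qstep s v Qs.
rewrite -[never (predU A B) s]mul1r; apply: never_le_add => n; rewrite mul1r.
elim: n s v Qs => [|n IH] s v Qs /=; case: (boolP (A s.1)) => As /=.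
- by rewrite never_in // addr0 (Q0 _ _ Qs).
- have /andP[_ h] := never_itv A s.
  case: ifPn => Bs; first by rewrite addr0; apply: (le_trans h); exact: (QB _ _ Qs).
  by apply: (le_trans h); rewrite lerDr (Q0 _ _ Qs).
- by rewrite never_in // addr0 (Q0 _ _ Qs).
- have /andP[_ h] := never_itv A s.
  case: ifPn => Bs; first by rewrite addr0; apply: (le_trans h); exact: (QB _ _ Qs).
  have [v1 [v2 [Q1 Q2 hv]]] := Qstep s v Qs As Bs.
  apply: le_trans (never_le_mean_step A s) _.
  have /andP[r0 r1] := prob_right_itv s.
  have h1 := ler_wpM2l (ltW r0) (IH _ _ Q1).
  have r1' : 0 <= 1 - prob_right p q s by rewrite subr_ge0 ltW.
  have h2 := ler_wpM2l r1' (IH _ _ Q2).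
  apply: le_trans (lerD h1 h2) _; rewrite /mean_step.
  set x := avoid _ _ _; set y := avoid _ _ _; set r := prob_right p q s in hv *.
  have -> : r * (v1 + x) + (1 - r) * (v2 + y) =
    r * v1 + (1 - r) * v2 + (r * x + (1 - r) * y) by ring.
  by rewrite lerD2r.
Qed.

(** Optional stopping over n steps for a process that may grow by [eta] on average in each step;
    [eta] will be the truncation error of the potential. *)
Lemma hit_supermartingale (Q : state -> K -> Prop) (A : pred int) (eta : K) :
  0 <= eta ->
  (forall s v, Q s v -> 0 <= v) ->
  (forall s v, Q s v -> A s.1 -> 1 <= v) ->
  (forall s v, Q s v -> ~~ A s.1 ->
    exists v1 v2, [/\ Q (step_right R s) v1, Q (step_left 1 s) v2 &
      prob_right p q s * v1 + (1 - prob_right p q s) * v2 <= v + eta]) ->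
  forall n s v, Q s v -> 1 - avoid A n s <= v + n%:R * eta.
Proof.
move=> eta0 Q0 QA Qstep; elim=> [|n IH] s v Qs /=; case: ifPn => As.
- by rewrite subr0 mul0r addr0 (QA _ _ Qs).
- by rewrite subrr mul0r addr0 (Q0 _ _ Qs).
- by rewrite subr0; apply: (le_trans (QA _ _ Qs As)); rewrite lerDl mulr_ge0.
have [v1 [v2 [Q1 Q2 hv]]] := Qstep s v Qs As.
have /andP[r0 r1] := prob_right_itv s.
have h1 := ler_wpM2l (ltW r0) (IH _ _ Q1).
have r1' : 0 <= 1 - prob_right p q s by rewrite subr_ge0 ltW.
have h2 := ler_wpM2l r1' (IH _ _ Q2).
rewrite /mean_step; move: h1 h2 hv; set x := avoid _ _ _; set y := avoid _ _ _.
rewrite -natr1; move: (prob_right p q s) (n%:R) => r m h1 h2 hv.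
have := lerD h1 h2.
have -> : r * (1 - x) + (1 - r) * (1 - y) = 1 - (r * x + (1 - r) * y) by ring.
move=> /le_trans; apply.
have -> : r * (v1 + m * eta) + (1 - r) * (v2 + m * eta) =
  r * v1 + (1 - r) * v2 + m * eta by ring.
have -> : v + (m + 1) * eta = v + eta + m * eta by ring.
by rewrite lerD2r.
Qed.

(** With probability at least [delta ^+ j] the next j jumps all go left and reach a; M is used only
    after a right jump. *)
Lemma never_run_left (I : state -> Prop) (A : pred int) (a : int) (M : K) :
  A a ->
  (forall s, I s -> ~~ A s.1 -> I (step_right R s) /\ I (step_left 1 s)) ->
  0 <= M -> (forall s, I s -> never A s <= M) ->
  forall (j : nat) s, I s -> s.1 = a + j%:Z -> never A s <= (1 - delta ^+ j) * M.
Proof.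
move=> Aa Istep M0 hM; have /andP[d0 d1] := delta_itv.
elim=> [|j IH] s Is sj.
  by rewrite never_in ?sj ?addr0 // expr0 subrr mul0r.
case: (boolP (A s.1)) => As.
  by rewrite never_in // mulr_ge0 // subr_ge0 exprn_ile1 // ltW.
have [IR IL] := Istep s Is As.
have hL : (step_left 1 s).1 = a + j%:Z by rewrite /= sj; lia.
have h1 := hM _ IR; have h2 := IH _ IL hL.
apply: le_trans (never_le_mean_step A s) _; rewrite /mean_step.
have /andP[r0 r1] := prob_right_itv s; have hr := prob_left_ge s.
have dj : 0 < delta ^+ j by exact: exprn_gt0.
move: h1 h2 r0 r1 hr; set x := never A _; set y := never A _.
move: (prob_right p q s) => r h1 h2 r0 r1 hr.
have h3 := ler_wpM2l (ltW r0) h1.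
have h4 : (1 - r) * y <= (1 - r) * ((1 - delta ^+ j) * M).
  by rewrite ler_wpM2l // subr_ge0 ltW.
apply: le_trans (lerD h3 h4) _.
have -> : r * M + (1 - r) * ((1 - delta ^+ j) * M) = (1 - (1 - r) * delta ^+ j) * M by ring.
by rewrite ler_wpM2r // lerD2l lerN2 exprS ler_pM2r.
Qed.

(** Iterating the hypothesis from the trivial bound 1 gives a geometric sequence of uniform
    bounds. *)
Lemma never_eq0_contraction (I : state -> Prop) (A : pred int) (N : nat) :
  (forall M, 0 <= M -> (forall s, I s -> never A s <= M) ->
     forall s, I s -> never A s <= (1 - delta ^+ N) * M) ->
  forall s, I s -> never A s = 0.
Proof.
move=> h s Is; have /andP[d0 d1] := delta_itv.
set rho := 1 - delta ^+ N in h.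
have rho0 : 0 <= rho by rewrite subr_ge0 exprn_ile1 // ltW.
have rho1 : rho < 1 by rewrite /rho gtrBl exprn_gt0.
have bnd n : forall s, I s -> never A s <= rho ^+ n.
  elim: n => [|n IH] t It; first by rewrite expr0; have /andP[] := never_itv A t.
  by rewrite exprS; apply: h => //; rewrite exprn_ge0.
apply/eqP; rewrite eq_le; have /andP[-> _] := never_itv A s; rewrite andbT.
have cv : rho ^+ n @[n --> \oo] --> (0 : K) by apply: cvg_expr; rewrite ger0_norm.
rewrite -(cvg_lim (@Rhausdorff K) cv); apply: limr_ge; last by apply: nearW => n; exact: bnd.
by apply/cvg_ex; exists 0.
Qed.

Lemma never_exit (A : pred int) (a b : int) (s : state) : A a -> A b -> a <= s.1 <= b ->
  never A s = 0.
Proof.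
move=> Aa Ab; move: s.
have Istep (s : state) : a <= s.1 <= b -> ~~ A s.1 ->
    a <= (step_right R s).1 <= b /\ a <= (step_left 1 s).1 <= b.
  have [->|na] := eqVneq s.1 a; first by rewrite Aa.
  have [->|nb] := eqVneq s.1 b; first by rewrite Ab.
  by rewrite /=; lia.
apply: (@never_eq0_contraction (fun s => a <= s.1 <= b) A `|b - a|%N) => M M0 hM s Is.
have /andP[d0 d1] := delta_itv.
have sj : s.1 = a + `|s.1 - a|%N%:Z by lia.
apply: le_trans (never_run_left Aa Istep M0 hM Is sj) _.
rewrite ler_wpM2r // lerD2l lerN2; apply: ler_wiXn2l; [exact: ltW|exact: ltW|lia].
Qed.

End Chain.

(** * Excursions *)

Section SiteShapes.
Variables (R : nat) (sigma : label).

(* The walk is [x] sites to the right of [a], and [a + b] is the rightmost site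
   visited so far; the sites above the walk were last left to the left. *)
Definition site_shape (a : int) (b x : nat) (s : state) : Prop :=
  [/\ s.1 = a + x%:Z, (x <= b)%N, forall y, Lambda R 1 (s.2 y) &
      forall j : nat, (x < j <= b)%N -> s.2 (a + j%:Z) = Lq 0].

Definition fresh_shape (a : int) (b x : nat) (s : state) : Prop :=
  site_shape a b x s /\ forall j : nat, (b < j)%N -> s.2 (a + j%:Z) = sigma.

Hypothesis hR : (0 < R)%N.

Lemma label_right_ok (s : label) : Lambda R 1 (label_right R s).
Proof. by case: s => i //=; case: ifP. Qed.

Lemma label_left1 (s : label) : label_left 1 s = Lq 0.
Proof. by case: s. Qed.

Lemma env_set_ok (e : env) (x : int) (s : label) :
  (forall y, Lambda R 1 (e y)) -> Lambda R 1 s ->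
  forall y, Lambda R 1 (env_set e x s y).
Proof. by move=> he hs y; rewrite /env_set; case: ifP. Qed.

Lemma step_right_ok (s : state) : (forall y, Lambda R 1 (s.2 y)) ->
  forall y, Lambda R 1 ((step_right R s).2 y).
Proof. by move=> h; apply: env_set_ok => //; exact: label_right_ok. Qed.

Lemma step_left_ok (s : state) : (forall y, Lambda R 1 (s.2 y)) ->
  forall y, Lambda R 1 ((step_left 1 s).2 y).
Proof. by move=> h; apply: env_set_ok => //; rewrite label_left1. Qed.

Lemma site_shape_left a b x s : site_shape a b x.+1 s ->
  site_shape a b x (step_left 1 s).
Proof.
move=> [s1 xb ok hj]; split => [|||j /andP[xj jb]] /=.
- by rewrite s1; lia.
- exact: ltnW.
- exact: step_left_ok.
- rewrite /env_set s1; case: eqP => [_|ne]; first by rewrite label_left1.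
  by apply: hj; rewrite jb andbT ltn_neqAle xj andbT; apply/eqP => E; apply: ne; rewrite E.
Qed.

Lemma site_shape_right a b x s : (x.+1 < b)%N -> site_shape a b x.+1 s ->
  site_shape a b x.+2 (step_right R s).
Proof.
move=> xb [s1 _ ok hj]; split => // [||j /andP[xj jb]] /=.
- by rewrite s1; lia.
- exact: step_right_ok.
- rewrite /env_set s1; case: eqP => [E|_]; first by lia.
  by apply: hj; lia.
Qed.

Lemma fresh_shape_left a b x s : fresh_shape a b x.+1 s ->
  fresh_shape a b x (step_left 1 s).
Proof.
move=> [hs hj]; split; first exact: site_shape_left.
have [s1 xb _ _] := hs.
by move=> j bj; rewrite /= /env_set s1; case: eqP => [E|_]; [lia | exact: hj].
Qed.

Lemma fresh_shape_right a b x s : (x.+1 < b)%N -> fresh_shape a b x.+1 s ->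
  fresh_shape a b x.+2 (step_right R s).
Proof.
move=> xb [hs hj]; split; first exact: site_shape_right.
have [s1 _ _ _] := hs.
by move=> j bj; rewrite /= /env_set s1; case: eqP => [E|_]; [lia | exact: hj].
Qed.

Lemma fresh_shape_max a x s : fresh_shape a x.+1 x.+1 s ->
  fresh_shape a x.+2 x.+2 (step_right R s).
Proof.
move=> [[s1 _ ok _] hj]; split; last first.
  by move=> j bj; rewrite /= /env_set s1; case: eqP => [E|_]; [lia | apply: hj; lia].
split; [by rewrite /= s1; lia | by [] | exact: step_right_ok |].
by move=> j; lia.
Qed.

End SiteShapes.

(** * Excursions as products over sites *)

Section Excursions.
Variables (K : realType) (p q : K) (R : nat).

Local Notation ext := (gam_iter p q R).

Definition label_gam (s : label) : K -> K :=
  match s with Lp _ => gam p q 0 | Lq i => gam p q (R - i) end.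

(* Expectation of t_k^Z in the situation of [site_shape a b x], where Z is the
   number of jumps from a + b to a + b + 1 before the walk reaches a. *)
Definition exc (k b x : nat) (a : int) (e : env) : K :=
  \prod_(j < x) label_gam (e (a + j.+1%:Z)) (ext (k + (b - j.+1))).

Hypotheses (hp : 0 < p < 1) (hq : 0 < q < 1) (hR : (0 < R)%N).
Hypothesis (hcrit : gam_mean p q R = 1).

Let kappa := p * q.
Let mmax := gam_mean p q 0 + R%:R.

Let kappa_itv : 0 < kappa < 1.
Proof.
have [p0 p1] := andP hp; have [q0 q1] := andP hq.
by rewrite /kappa; apply/andP; split; nra.
Qed.

Lemma label_gamE (s : label) : Lambda R 1 s ->
  exists2 j, (j <= R)%N & label_gam s = gam p q j.
Proof. by case: s => i _; [exists 0%N | exists (R - i)%N; rewrite // leq_subr]. Qed.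

Lemma label_gam_itv (s : label) (k : nat) : Lambda R 1 s ->
  0 < label_gam s (ext k) <= 1 - kappa * (1 - ext k).
Proof.
move=> /label_gamE[j _ ->]; have h := gam_iter_itvW R hp hq k.
by rewrite gam_gt0 // gam_le.
Qed.

Lemma label_gam_lower (s : label) (k : nat) : Lambda R 1 s ->
  1 - mmax * (1 - ext k) <= label_gam s (ext k).
Proof.
move=> /label_gamE[j jR ->]; have h := gam_iter_itvW R hp hq k.
apply: le_trans (gam_lower hp hq j h); rewrite lerD2l lerN2 ler_wpM2r //.
  by rewrite subr_ge0; case/andP: h.
exact: gam_mean_le.
Qed.

Lemma label_gam_le1 (s : label) (k : nat) : Lambda R 1 s ->
  0 < label_gam s (ext k) <= 1.
Proof.
move=> /(label_gam_itv k) /andP[-> h]; apply: (le_trans h).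
have /andP[k0 _] := kappa_itv; have /andP[_ e1] := gam_iter_itvW R hp hq k.
by rewrite gerBl mulr_ge0 ?subr_ge0 // ltW.
Qed.

(** Conditioning on the next jump: a right jump contributes t and updates the label. At (p,0) the
    label is unchanged and the closed form solves a fixed-point equation; after (q,R-1) the index of
    [gam] has dropped to 0, which is (p,0). *)
Lemma label_gam_step (s : label) (t : K) : Lambda R 1 s -> t <= 1 ->
  let r := match s with Lp _ => p | Lq _ => q end in
  label_gam s t = 1 - r + r * t * label_gam (label_right R s) t.
Proof.
have [p0 p1] := andP hp.
case: s => i /= hi t1; last first.
  have -> : (R - i = (R - i.+1).+1)%N by lia.
  case: ifP => //= h; suff -> : (R - i.+1 = 0)%N by [].
  by lia.
have h : p * t <= p by rewrite ler_piMr // ltW.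
by field; rewrite gt_eqF //; lra.
Qed.

Lemma exc_eq k b x a (e e' : env) :
  (forall j : nat, (0 < j <= x)%N -> e (a + j%:Z) = e' (a + j%:Z)) ->
  exc k b x a e = exc k b x a e'.
Proof. by move=> h; apply: eq_bigr => j _; rewrite h ?ltn_ord. Qed.

Lemma exc_itv k b x a (e : env) : (forall y, Lambda R 1 (e y)) ->
  0 < exc k b x a e <= 1.
Proof.
move=> he; apply/andP; split.
  by apply: prodr_gt0 => j _; have /andP[] := label_gam_le1 (k + (b - j.+1)) (he (a + j.+1%:Z)).
apply: (@numdomain.Num.Theory.prodr_ile1 K) => j _.
by have /andP[/ltW -> ->] := label_gam_le1 (k + (b - j.+1)) (he (a + j.+1%:Z)).
Qed.

Lemma exc_le k b a (e : env) : (forall y, Lambda R 1 (e y)) ->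
  exc k b b a e <= (1 + kappa * \sum_(i < b) (1 - ext (k + i)))^-1.
Proof.
move=> he; rewrite mulr_sumr.
apply: le_trans (@prodr_1B_le _ (fun i => kappa * (1 - ext (k + i))) b _); last first.
  move=> i; have /andP[e0 e1] := gam_iter_itvW R hp hq (k + i).
  have /andP[k0 k1] := kappa_itv.
  by apply/andP; split; nra.
rewrite (reindex_inj rev_ord_inj) /exc /=.
apply: ler_prod => j _.
by have /andP[/ltW -> ->] := label_gam_itv (k + (b - j.+1)) (he (a + j.+1%:Z)).
Qed.

(** Each factor differs from 1 by at most [mmax] times one minus its argument, and t_k is the
    smallest argument. For fixed x this makes the terms with large k negligible. *)
Lemma exc_ge k b x a (e : env) : (forall y, Lambda R 1 (e y)) ->
  1 - exc k b x a e <= x%:R * mmax * (1 - ext k).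
Proof.
move=> he.
pose f (j : nat) := 1 - label_gam (e (a + j.+1%:Z)) (ext (k + (b - j.+1))).
have hf j : 0 <= f j <= 1.
  have /andP[l0 l1] := label_gam_le1 (k + (b - j.+1)) (he (a + j.+1%:Z)).
  by rewrite /f subr_ge0 l1 gerBl ltW.
have -> : exc k b x a e = \prod_(j < x) (1 - f j).
  by apply: eq_bigr => j _; rewrite /f subKr.
have /andP[h _] := prodr_1B_ge x hf.
have mm0 : 0 <= mmax by rewrite addr_ge0 // ltW // gam_mean_gt0.
have h2 : \sum_(i < x) f i <= \sum_(i < x) mmax * (1 - ext k).
  apply: ler_sum => j _; rewrite lerBlDr addrC -lerBlDr.
  apply: le_trans (label_gam_lower _ (he _)); rewrite lerD2l lerN2 ler_wpM2l //.
  by apply: gam_iter_nondecr => //; rewrite leq_addr.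
have h3 : \sum_(i < x) mmax * (1 - ext k) = x%:R * mmax * (1 - ext k).
  by rewrite sumr_const card_ord -[LHS]mulr_natl mulrA.
move: h2 h; rewrite h3; lra.
Qed.

Section Step.
Variables (a : int) (b x : nat) (s : state).
Hypothesis (hs : site_shape R a b x.+1 s).

(** A left jump leaves the factors of the lower sites. A right jump starts an excursion above, with
    generating function t_(k + b - x - 1), after which the same site is used again with its new
    label. *)
Lemma exc_step k : exc k b x.+1 a s.2 =
  (1 - prob_right p q s) * exc k b x a (step_left 1 s).2 +
  prob_right p q s * (ext (k + (b - x.+1)) * exc k b x.+1 a (step_right R s).2).
Proof.
have [s1 xb ok _] := hs.
have hQ l : exc k b x a (env_set s.2 s.1 l) = exc k b x a s.2.
  by apply: exc_eq => j jx; rewrite /env_set s1; case: eqP => // E; lia.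
have hQ' l : exc k b x.+1 a (env_set s.2 s.1 l) =
    exc k b x a s.2 * label_gam l (ext (k + (b - x.+1))).
  by rewrite -(hQ l) /exc big_ord_recr /= /env_set s1 eqxx.
rewrite /= hQ hQ' /exc big_ord_recr /= -s1 -/(exc k b x a s.2).
have /andP[_ t1] := gam_iter_itvW R hp hq (k + (b - x.+1)).
rewrite (label_gam_step (ok s.1) t1) /prob_right.
set r := match s.2 s.1 with Lp _ => p | Lq _ => q end; ring.
Qed.

(** Below the maximum the next site is in state (q,0), so its factor is g(t_(k + b - x - 2)), the
    iterate on the left. *)
Lemma exc_right k : (x.+1 < b)%N ->
  ext (k + (b - x.+1)) * exc k b x.+1 a (step_right R s).2 =
  exc k b x.+2 a (step_right R s).2.
Proof.
move=> xb; have [_ _ _ hj] := hs.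
rewrite [RHS]/exc big_ord_recr /= mulrC -/(exc k b x.+1 a _); congr (_ * _).
have -> : env_set s.2 s.1 (label_right R (s.2 s.1)) (a + x.+2%:Z) = Lq 0.
  have [-> _ _ _] := hs; rewrite /env_set; case: eqP => [E|_]; first by lia.
  by apply: hj; lia.
by rewrite /= subn0; have -> : (k + (b - x.+1) = (k + (b - x.+2)).+1)%N by lia.
Qed.

End Step.

(* By [exc_step], [exc 0 L L] is the probability that the walk goes down [L]
   levels before climbing one. *)
Lemma never_up (s : state) : (forall y, Lambda R 1 (s.2 y)) ->
  never p q R (pred1 (s.1 + 1)) s = 0.
Proof.
move=> ok; apply/eqP; rewrite eq_le; have /andP[-> _] := never_itv R hp hq (pred1 (s.1 + 1)) s.
rewrite andbT; apply/ler_addgt0Pr => d d0; rewrite add0r.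
have /andP[k0 _] := kappa_itv.
have [L hL] := gam_iter_tail_unbounded hp hq hR hcrit 0 (d^-1 / kappa).
have {}hL : d^-1 / kappa <= \sum_(i < L) (1 - ext i) by exact: (hL L (leqnn _) 0%N).
set a := s.1 - L%:Z.
pose Q (t : state) (v : K) := (exists2 x, site_shape R a L x t & v = exc 0 L x a t.2) \/
  (t.1 = s.1 + 1 /\ v = 0).
have sL : site_shape R a L L s by split => //; rewrite /a; lia.
have Qs : Q s (exc 0 L L a s.2) by left; exists L.
apply: le_trans (never_supermartingale hp hq (A := pred1 (s.1 + 1)) (B := pred1 a) _ _ _ Qs) _.
- move=> t v [[x [_ _ okt _] ->]|[_ ->]] //.
  by have /andP[/ltW] := exc_itv 0 L x a okt.
- move=> t v [[x [t1 _ _ _] ->]|[-> _]] /eqP E; last by move: E; rewrite /a; lia.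
  by have -> : x = 0%N; [lia | rewrite /exc big_ord0].
- move=> t v [[[|x] ht ->]|[-> _]]; last by rewrite /= eqxx.
    by have [-> _ _ _] := ht; rewrite /= addr0 eqxx.
  move=> _ _; have hl := site_shape_left hR ht.
  have [xL|xL] := ltnP x.+1 L.
    exists (exc 0 L x.+2 a (step_right R t).2), (exc 0 L x a (step_left 1 t).2).
    split; [by left; exists x.+2 => //; exact: site_shape_right | by left; exists x |].
    by rewrite (exc_step ht) (exc_right ht) // addrC.
  exists 0, (exc 0 L x a (step_left 1 t).2).
  have [t1 xL' _ _] := ht; have EL : L = x.+1 by lia.
  split; [|by left; exists x|].
    by right; split => //=; rewrite t1 /a; lia.
  by rewrite (exc_step ht) EL subnn /= mul0r !mulr0 addr0 add0r.
have -> : never p q R (predU (pred1 (s.1 + 1)) (pred1 a)) s = 0.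
  apply: (@never_exit _ _ _ _ hp hq _ a (s.1 + 1)) => /=; rewrite ?eqxx ?orbT //.
  by rewrite /a; lia.
rewrite addr0; apply: le_trans (exc_le 0 L a ok) _.
have S0 : 0 <= \sum_(i < L) (1 - ext (0 + i)).
  by apply: sumr_ge0 => i _; have /andP[_] := gam_iter_itvW R hp hq (0 + i); rewrite subr_ge0.
have kS0 := mulr_ge0 (ltW k0) S0.
rewrite -[leRHS]invrK lef_pV2 ?posrE ?invr_gt0 //; last lra.
move: hL; rewrite ler_pdivrMr // mulrC => hL; apply: (le_trans hL); rewrite lerDr ler01 //.
Qed.

End Excursions.

(** * The truncated martingale to the right *)

Section RightExcursions.
Variables (K : realType) (p q : K) (R J : nat) (sigma : label).

Local Notation ext := (gam_iter p q R).
Local Notation weight := (weight p q R J).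
Local Notation exc := (exc p q R).

(** Subtracted from the sum of the first n weights, this is the truncated harmonic function written
    on the state of the walk. *)
Definition potential (n b x : nat) (a : int) (e : env) : K :=
  \sum_(k < n) weight k * exc k b x a e.

Hypotheses (hp : 0 < p < 1) (hq : 0 < q < 1) (hR : (0 < R)%N).
Hypothesis (hcrit : gam_mean p q R = 1).
Hypothesis (hsigma : label_gam p q R sigma = gam p q J).

Let w_gt0 k : 0 < weight k. Proof. exact: weight_gt0. Qed.

Lemma potential_step n a b x s : (x.+1 < b)%N -> fresh_shape R sigma a b x.+1 s ->
  prob_right p q s * potential n b x.+2 a (step_right R s).2 +
  (1 - prob_right p q s) * potential n b x a (step_left 1 s).2 =
  potential n b x.+1 a s.2.
Proof.
move=> xb [hs _]; rewrite !mulr_sumr -big_split /=; apply: eq_bigr => k _.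
by rewrite (exc_step hp hq hR hs) (exc_right hp hq hR hs) //; ring.
Qed.

(* A new maximum shifts k by one in [exc]; the weights are chosen so that the sum
   over k then telescopes. *)
Lemma potential_max n a x s : fresh_shape R sigma a x.+1 x.+1 s ->
  prob_right p q s * potential n x.+2 x.+2 a (step_right R s).2 +
  (1 - prob_right p q s) * potential n x.+1 x a (step_left 1 s).2 =
  potential n x.+1 x.+1 a s.2 + prob_right p q s *
    (weight n * ext n * exc n x.+1 x.+1 a (step_right R s).2).
Proof.
move=> [hs hj].
pose F k := weight k * ext k * exc k x.+1 x.+1 a (step_right R s).2.
have hF k : weight k * exc k x.+2 x.+2 a (step_right R s).2 = F k.+1.
  rewrite /F weightS // /exc big_ord_recr /= subnn addn0.
  have -> : env_set s.2 s.1 (label_right R (s.2 s.1)) (a + x.+2%:Z) = sigma.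
    have [-> _ _ _] := hs; rewrite /env_set; case: eqP => [E|_]; first by lia.
    by apply: hj.
  rewrite hsigma [X in _ * X]mulrC mulrA; congr (_ * _).
  apply: eq_bigr => j _ /=.
  by have -> : (k + (x.+2 - j.+1) = k.+1 + (x.+1 - j.+1))%N by have := ltn_ord j; lia.
have tele m : \sum_(k < m) F k.+1 = \sum_(k < m) F k + F m.
  elim: m => [|m IH]; first by rewrite !big_ord0 add0r /F /gam_iter /= mulr0 mul0r.
  by rewrite !big_ord_recr /= IH.
have -> : potential n x.+2 x.+2 a (step_right R s).2 = \sum_(k < n) F k + F n.
  by rewrite -tele; apply: eq_bigr => k _; exact: hF.
have -> : potential n x.+1 x.+1 a s.2 = prob_right p q s * \sum_(k < n) F k +
    (1 - prob_right p q s) * potential n x.+1 x a (step_left 1 s).2.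
  rewrite !mulr_sumr -big_split /=; apply: eq_bigr => k _.
  by rewrite (exc_step hp hq hR hs) subnn addn0 /F; ring.
rewrite -/(F n); ring.
Qed.

Let W n := \sum_(k < n) weight k.

Let W_ge1 n : (0 < n)%N -> 1 <= W n.
Proof.
case: n => // n _; rewrite /W big_ord_recl weight0 lerDl.
by apply: sumr_ge0 => i _; exact: ltW.
Qed.

Lemma potential_itv n b x a e : (forall y, Lambda R 1 (e y)) ->
  0 <= potential n b x a e <= W n.
Proof.
move=> ok; apply/andP; split.
  by apply: sumr_ge0 => k _; have /andP[/ltW h _] := exc_itv hp hq k b x a ok;
     rewrite mulr_ge0 // ltW.
apply: ler_sum => k _; have /andP[_ h] := exc_itv hp hq k b x a ok.
by rewrite -[leRHS]mulr1 ler_wpM2l // ltW.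
Qed.

Lemma potential0 n b a e : potential n b 0 a e = W n.
Proof. by apply: eq_bigr => k _; rewrite /exc big_ord0 mulr1. Qed.

Lemma exc_small n (d : K) : 0 < d -> exists L0, forall L, (L0 <= L)%N ->
  forall k a e, (k <= n)%N -> (forall y, Lambda R 1 (e y)) -> exc k L L a e <= d.
Proof.
move=> d0; have [p0 _] := andP hp; have [q0 _] := andP hq.
have k0 : 0 < p * q by rewrite mulr_gt0.
have [L0 hL] := gam_iter_tail_unbounded hp hq hR hcrit n (d^-1 / (p * q)).
exists L0 => L /hL {}hL k a e /hL {}hL ok; apply: le_trans (exc_le hp hq k L a ok) _.
set S := \sum_(i < L) _ in hL *.
have S0 : 0 <= S.
  by apply: sumr_ge0 => i _; have /andP[_] := gam_iter_itvW R hp hq (k + i); rewrite subr_ge0.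
have kS0 := mulr_ge0 (ltW k0) S0.
rewrite -[leRHS]invrK lef_pV2 ?posrE ?invr_gt0 //; last lra.
by move: hL; rewrite ler_pdivrMr // mulrC => hL; apply: (le_trans hL); rewrite lerDr.
Qed.

(** When the sum [W n] of the weights diverges, 2 (W n - potential) / W n is a supermartingale that
    is small at s for large n, yet at least 1 when the walk first reaches a distant a + L. So a is
    very likely hit first. *)
Lemma never_left_recurrent a b x s : gam_mean p q J <= 1 + gam_curv p q R 1 ->
  fresh_shape R sigma a b x s -> never p q R (pred1 a) s = 0.
Proof.
move=> hJ hs; apply/eqP; rewrite eq_le; have /andP[-> _] := never_itv R hp hq (pred1 a) s.
rewrite andbT; apply/ler_addgt0Pr => d d0; rewrite add0r.
have [p0 p1] := andP hp; have [q0 q1] := andP hq.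
set C := x%:R * (gam_mean p q 0 + R%:R).
have C0 : 0 <= C by rewrite mulr_ge0 // addr_ge0 // ltW // gam_mean_gt0.
(* One factor 2 comes from the supermartingale, the other from splitting the sum at [n1]; C vanishes
   when x = 0, hence C + 1. *)
set d1 := d / (4 * (C + 1)).
have d10 : 0 < d1 by rewrite divr_gt0 // mulr_gt0 //; lra.
have [n1 hn1] := gam_iter_cvg1 hp hq hR hcrit d10.
have [n hn] := weight_sum_unbounded hp hq hR hcrit (W n1.+1 / d1) hJ.
rewrite -/(W n) in hn.
have W0 : 1 <= W n1.+1 by exact: W_ge1.
have Wn0 : 0 < W n by apply: lt_le_trans hn; rewrite divr_gt0 //; lra.
have hW : W n1.+1 <= d1 * W n by move: hn; rewrite ler_pdivrMr // mulrC.
(* L is chosen after n: at a + L the potential is then at most half of [W n], which the factor 2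
   turns into the value 1. *)
have [L0 hL] := @exc_small n 2^-1 ltac:(by rewrite invr_gt0).
have [L bL {}hL] : exists2 L, (b < L)%N & forall k a e, (k <= n)%N ->
    (forall y, Lambda R 1 (e y)) -> exc k L L a e <= 2^-1.
  by exists (maxn L0 b.+1); [rewrite leq_max ltnSn orbT | apply: hL; rewrite leq_maxl].
pose Q (t : state) (v : K) := exists b' x', [/\ fresh_shape R sigma a b' x' t, (b' <= L)%N &
  v = 2 * (W n - potential n b' x' a t.2) / W n].
have Qs : Q s (2 * (W n - potential n b x a s.2) / W n).
  by exists b, x; split => //; exact: ltnW.
apply: le_trans (never_supermartingale hp hq (A := pred1 a) (B := pred1 (a + L%:Z)) _ _ _ Qs) _.
- move=> t v [b' [x' [[[_ _ ok _] _] _ ->]]].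
  have /andP[_ h] := potential_itv n b' x' a ok.
  by rewrite divr_ge0 ?(ltW Wn0) // mulr_ge0 // subr_ge0.
- move=> t v [b' [x' [[[t1 xb ok _] _] bL' ->]]] /eqP E.
  have Ex : x' = L by move: E; rewrite t1 => /addrI [->].
  have Eb : b' = L by apply/anti_leq; rewrite bL' -Ex.
  subst x' b'.
  rewrite ler_pdivlMr // mul1r.
  have : potential n L L a t.2 <= W n * 2^-1.
    rewrite /W mulr_suml; apply: ler_sum => k _; rewrite ler_wpM2l ?(ltW (w_gt0 _)) //.
    by apply: hL => //; exact: ltnW.
  by lra.
- move=> t v [b' [[|x'] [ht bL' ->]]] /eqP At /eqP Bt.
    by have [[t1 _ _ _] _] := ht; exfalso; apply: At; rewrite t1 addr0.
  have hl := fresh_shape_left hR ht.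
  have [[t1 xb ok _] _] := ht.
  have [xL|xL] := ltnP x'.+1 b'.
    exists (2 * (W n - potential n b' x'.+2 a (step_right R t).2) / W n).
    exists (2 * (W n - potential n b' x' a (step_left 1 t).2) / W n).
    split; [by exists b', x'.+2; split => //; exact: fresh_shape_right
           | by exists b', x'; split |].
    rewrite -(potential_step n xL ht) le_eqVlt; apply/orP; left; apply/eqP.
    by field; rewrite gt_eqF.
  have Eb : b' = x'.+1 by apply/anti_leq; rewrite xL.
  subst b'.
  exists (2 * (W n - potential n x'.+2 x'.+2 a (step_right R t).2) / W n).
  exists (2 * (W n - potential n x'.+1 x' a (step_left 1 t).2) / W n).
  split.
  + exists x'.+2, x'.+2; split => //; first exact: fresh_shape_max.
    by rewrite ltn_neqAle bL' andbT; apply/eqP => EL; apply: Bt; rewrite t1 EL.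
  + by exists x'.+1, x'; split.
  have := potential_max n ht.
  set X := weight n * _ * _; set r := prob_right _ _ _; set P1 := potential _ _ _ _ _.
  set P2 := potential _ _ _ _ _; set P3 := potential _ _ _ _ _ => E.
  have X0 : 0 <= r * X.
    have /andP[r0 _] := prob_right_itv hp hq t.
    have /andP[e0 _] := gam_iter_itvW R hp hq n.
    have /andP[x0 _] := exc_itv hp hq n x'.+1 x'.+1 a (step_right_ok ok).
    by rewrite !mulr_ge0 ?(ltW r0) ?(ltW x0) ?(ltW (w_gt0 _)).
  have -> : r * (2 * (W n - P1) / W n) + (1 - r) * (2 * (W n - P2) / W n) =
     2 * (W n - (r * P1 + (1 - r) * P2)) / W n by field; rewrite gt_eqF.
  rewrite E ler_wpM2r ?invr_ge0 ?(ltW Wn0) // ler_wpM2l //; lra.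
have [[s1 xb ok _] _] := hs.
have -> : never p q R (predU (pred1 a) (pred1 (a + L%:Z))) s = 0.
  apply: (@never_exit _ _ _ _ hp hq _ a (a + L%:Z)) => /=; rewrite ?eqxx ?orbT //.
  by rewrite s1 lerDl lerD2l !lez_nat (leq_trans xb (ltnW bL)).
rewrite addr0 ler_pdivrMr //.
have h1 : W n - potential n b x a s.2 <= \sum_(k < n) weight k * (C * (1 - ext k)).
  rewrite /W /potential -sumrB; apply: ler_sum => k _.
  rewrite -[X in X - _]mulr1 -mulrBr ler_wpM2l ?(ltW (w_gt0 _)) //.
  exact: exc_ge.
have h2 : \sum_(k < n) weight k * (C * (1 - ext k)) <= C * (W n1.+1 + d1 * W n).
  have -> : C * (W n1.+1 + d1 * W n) =
      C * W n1.+1 + \sum_(k < n) weight k * (C * d1).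
    by rewrite -mulr_suml -/(W n); ring.
  have hk k : weight k * (C * (1 - ext k)) <=
      (if (k < n1.+1)%N then C * weight k else 0) + weight k * (C * d1).
    case: ltnP => hk.
      apply: ler_wpDr; first by apply: mulr_ge0; [exact: ltW | apply: mulr_ge0 => //; exact: ltW].
      rewrite [leRHS]mulrC ler_wpM2l ?(ltW (w_gt0 _)) // -[leRHS]mulr1 ler_wpM2l //.
      by have /andP[e0 _] := gam_iter_itvW R hp hq k; rewrite gerBl.
    rewrite add0r ler_wpM2l ?(ltW (w_gt0 _)) // ler_wpM2l // hn1 //; exact: ltnW.
  apply: (@le_trans _ _ (\sum_(k < n)
      ((if (k < n1.+1)%N then C * weight k else 0) + weight k * (C * d1)))).
    by apply: ler_sum => k _; exact: hk.
  rewrite big_split /= lerD2r.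
  rewrite /W mulr_sumr -big_mkcond /=.
  have [nW|nW] := leqP n1.+1 n.
    by rewrite (big_ord_widen n (fun k => C * weight k) nW).
  apply: (@le_trans _ _ (\sum_(k < n) C * weight k)).
    by rewrite big_mkcond; apply: ler_sum => k _; case: ifP => // _; rewrite mulr_ge0 // ltW.
  rewrite -(subnKC (ltnW nW)) big_split_ord /= lerDl.
  by apply: sumr_ge0 => i _; rewrite mulr_ge0 // ltW.
have -> : d * W n = 4 * (C + 1) * d1 * W n.
  by rewrite /d1; field; rewrite gt_eqF //; lra.
have h3 : C * (W n1.+1 + d1 * W n) <= C * (2 * (d1 * W n)).
  by rewrite ler_wpM2l //; lra.
have dW : 0 < d1 * W n by rewrite mulr_gt0.
by nra.
Qed.

End RightExcursions.

(** * Long-time behaviour *)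

Section LongTime.
Variables (K : realType) (p q : K) (R J : nat) (sigma : label).

Local Notation weight := (weight p q R J).
Local Notation avoid := (avoid p q R).
Local Notation never := (never p q R).
Local Notation mean := (mean_step p q R).

(* Holds along the whole trajectory: the sites beyond N and to the right of the
   walk are in state (q,0) up to the running maximum [B] and untouched beyond. *)
Definition recent (N : int) (s : state) : Prop :=
  (forall y, Lambda R 1 (s.2 y)) /\
  exists B : int, [/\ N <= B, s.1 <= B,
    forall y, N < y -> s.1 < y -> y <= B -> s.2 y = Lq 0 &
    forall y, B < y -> s.2 y = sigma].

(** Preserved until the walk hits N, where it yields a [fresh_shape] with the walk at its
    maximum. *)
Definition pristine (N : int) (s : state) : Prop :=
  [/\ forall y, Lambda R 1 (s.2 y), s.1 <= N & forall y, N <= y -> s.2 y = sigma].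

Hypothesis (hR : (0 < R)%N).

Lemma recent_step (N : int) (s : state) : recent N s ->
  recent N (step_right R s) /\ recent N (step_left 1 s).
Proof.
move=> [ok [B [NB sB h0 hs]]]; split; split.
- exact: step_right_ok.
- exists (Num.max B (s.1 + 1)); split => [|||y yB] /=.
  + by rewrite le_max NB.
  + by rewrite le_max lexx orbT.
  + move=> y Ny sy; rewrite le_max => /orP[yB|]; last by lia.
    rewrite /env_set; case: eqP => [E|_]; first by lia.
    by apply: h0 => //; lia.
  + move: yB; rewrite gt_max => /andP[yB _].
    by rewrite /env_set; case: eqP => [E|_]; [lia | exact: hs].
- exact: step_left_ok.
- exists B; split => //= [|y Ny sy yB|y yB]; first by lia.
  + rewrite /env_set; case: eqP => [E|ne]; first by rewrite label_left1.
    by apply: h0 => //; lia.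
  + by rewrite /env_set; case: eqP => [E|_]; [lia | exact: hs].
Qed.

Lemma pristine_step (N : int) (s : state) : pristine N s -> s.1 != N ->
  pristine N (step_right R s) /\ pristine N (step_left 1 s).
Proof.
move=> [ok sN h] ne; split; split => /=; try lia.
- exact: step_right_ok.
- by move=> y Ny; rewrite /env_set; case: eqP => [E|_]; [lia | exact: h].
- exact: step_left_ok.
- by move=> y Ny; rewrite /env_set; case: eqP => [E|_]; [lia | exact: h].
Qed.

Hypotheses (hp : 0 < p < 1) (hq : 0 < q < 1).
Hypothesis (hcrit : gam_mean p q R = 1).

Lemma never_up_nat (n : nat) (s : state) : (forall y, Lambda R 1 (s.2 y)) ->
  never (pred1 (s.1 + n%:Z)) s = 0.
Proof.
move=> ok; elim: n => [|n IH]; first by apply: never_in => //=; rewrite addr0.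
apply/eqP; rewrite eq_le.
have /andP[-> _] := never_itv R hp hq (pred1 (s.1 + n.+1%:Z)) s; rewrite andbT.
pose I (t : state) := forall y, Lambda R 1 (t.2 y).
have h := @never_trans K p q R hp hq I (pred1 (s.1 + n%:Z)) (pred1 (s.1 + n.+1%:Z)) 0.
rewrite -[leRHS](addr0 0) -[X in _ <= _ + X]IH; apply: h => //.
  by move=> t It _; split; [exact: step_right_ok | exact: step_left_ok].
move=> t It /eqP tn.
have -> : s.1 + n.+1%:Z = t.1 + 1 by rewrite tn; lia.
by rewrite never_up.
Qed.

Section Recurrent.
Hypothesis (hsigma : label_gam p q R sigma = gam p q J).
Hypothesis (hJ : gam_mean p q J <= 1 + gam_curv p q R 1).

Lemma never_recent (N : int) (s : state) : recent N s -> never (pred1 N) s = 0.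
Proof.
move=> [ok [B [NB sB h0 hs]]].
have [Ns|sN] := leP N s.1; last first.
  have -> : N = s.1 + `|N - s.1|%N%:Z by lia.
  exact: never_up_nat.
apply: (@never_left_recurrent _ _ _ R J sigma hp hq hR hcrit hsigma N
  `|B - N|%N `|s.1 - N|%N s hJ).
split; last by move=> j hj; apply: hs; lia.
split; [by lia | by lia | exact: ok |].
by move=> j hj; apply: h0; lia.
Qed.

(** N is reached from every [recent] state, and each time N left jumps in a row lead to 0 with
    probability bounded below, whatever the environment between them. *)
Lemma never_zero (N : nat) (s : state) : recent N%:Z s -> never (pred1 0) s = 0.
Proof.
move: s; apply: (@never_eq0_contraction _ _ _ _ hp hq _ _ N) => M M0 hM s hs.
set c := (1 - _) * M; rewrite -[leRHS]addr0 -(never_recent hs).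
apply: (never_trans hp hq (I := recent N%:Z)) => //.
- by move=> t ht _; exact: recent_step.
- rewrite /c mulr_ge0 // subr_ge0.
  have [p0 p1] := andP hp; have [q0 q1] := andP hq.
  by rewrite exprn_ile1 //; nra.
- move=> t ht /eqP tN.
  apply: (never_run_left hp hq (I := recent N%:Z) (a := 0)) => //=.
  by move=> u hu _; exact: recent_step.
Qed.

Lemma iter_mean_step_avoid0 (N : nat) (k : nat) (s : state) : recent N%:Z s ->
  iter k mean (avoid (pred1 0) m) s @[m --> \oo] --> (0 : K).
Proof.
elim: k s => [|k IH] s hs.
  by rewrite -(never_zero hs); exact: avoid_cvg.
have [hr hl] := recent_step hs.
have -> : (0 : K) = prob_right p q s * 0 + (1 - prob_right p q s) * 0 by rewrite !mulr0 addr0.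
by apply: cvgD; apply: cvgMr; exact: IH.
Qed.

End Recurrent.

Section Transient.
Hypothesis (hsigma : label_gam p q R sigma = gam p q J).
Hypothesis (hJ : 1 + gam_curv p q R 1 < gam_mean p q J).

Let w_gt0 k : 0 < weight k. Proof. exact: weight_gt0. Qed.

(** Otherwise disjoint blocks, each of sum above d, would exceed the bound on the partial sums. *)
Lemma weight_tail (d : K) : 0 < d ->
  exists n0, forall n, \sum_(k < n) weight (n0 + k) <= d.
Proof.
move=> d0; have [B B0 hB] := weight_sum_bounded hp hq hR hcrit hJ.
apply: contrapT => /forallNP h.
have h' n0 : exists n, d < \sum_(k < n) weight (n0 + k).
  have /existsNP[n /negP hn] := h n0; exists n; by rewrite ltNge.
have big m : exists n, m%:R * d <= \sum_(k < n) weight k.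
  elim: m => [|m [n hn]]; first by exists 0%N; rewrite big_ord0 mul0r.
  have [n' hn'] := h' n; exists (n + n')%N.
  by rewrite big_split_ord /= -natr1 mulrDl mul1r lerD // ltW.
have [n hn] := big (Num.truncn (B / d)).+1.
have : B < (Num.truncn (B / d)).+1%:R * d by rewrite -ltr_pdivrMr //; exact: truncnS_gt.
by have := hB n; lra.
Qed.

(** The potential divided by [W n] equals 1 at a, is small far to the right because the weights are
    summable, and grows on average by at most [weight n] per step. *)
Lemma escape (d : K) : 0 < d -> exists X0, forall x a s, (X0 <= x)%N ->
  fresh_shape R sigma a x x s ->
  forall m, 1 - avoid (fun y => y <= a) m s <= d.
Proof.
move=> d0; have d30 : 0 < d / 3 by rewrite divr_gt0.
have [n0 hn0] := weight_tail d30.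
set W := fun n => \sum_(k < n) weight k.
have W_ge0 n : 0 <= W n by apply: sumr_ge0 => k _; exact: ltW.
have W_ge1 n : (0 < n)%N -> 1 <= W n.
  case: n => // n _; rewrite /W big_ord_recl weight0 lerDl.
  by apply: sumr_ge0 => i _; exact: ltW.
(* [W n0] is 0 when [n0] is 0, hence the added 1. *)
have e0 : 0 < d / 3 / (W n0 + 1) by rewrite divr_gt0 // ltr_wpDl.
have [X0 hX0] := exc_small hp hq hR hcrit n0 e0.
exists X0 => x a s /hX0 {}hX0 hs m.
(* Only the truncation depends on the horizon m; [X0] was fixed before. *)
have [n1 hn1] : exists n1, forall n, \sum_(k < n) weight (n1 + k) <= d / 3 / m.+1%:R.
  by apply: weight_tail; rewrite divr_gt0.
set n := (n0 + n1.+1)%N.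
have wn : m%:R * weight n <= d / 3.
  have : weight n <= d / 3 / m.+1%:R.
    apply: le_trans (hn1 n0.+2); rewrite big_ord_recr /=.
    have -> : (n1 + n0.+1 = n)%N by rewrite /n addnC addSnnS.
    by rewrite lerDr; apply: sumr_ge0 => i _; exact: ltW.
  rewrite ler_pdivlMr // => hw; apply: le_trans hw; rewrite mulrC ler_wpM2l ?(ltW (w_gt0 _)) //.
  by rewrite ler_nat.
have Wn1 : 1 <= W n by apply: W_ge1; rewrite /n addnS.
have Wn0 : 0 < W n by lra.
pose P b x (t : state) := potential p q R J n b x a t.2.
pose Q (t : state) (v : K) := exists b' x', fresh_shape R sigma a b' x' t /\
  v = P b' x' t / W n.
have Qs : Q s (P x x s / W n) by exists x, x.
have hit := @hit_supermartingale K p q R hp hq Q (fun y => y <= a) (weight n) (ltW (w_gt0 n)).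
apply: le_trans (hit _ _ _ m s _ Qs) _.
- move=> t v [b' [x' [[[_ _ ok _] _] ->]]].
  have /andP[h _] := potential_itv J hp hq n b' x' a ok.
  by rewrite divr_ge0 // ltW.
- move=> t v [b' [x' [[[t1 _ ok _] _] ->]]] ta.
  have -> : x' = 0%N by move: ta; rewrite t1 gerDl lez_nat leqn0 => /eqP.
  by rewrite /P potential0 // divff // gt_eqF.
- move=> t v [b' [[|x'] [ht ->]]] ta.
    by have [[t1 _ _ _] _] := ht; move: ta; rewrite t1 addr0 lexx.
  have hl := fresh_shape_left hR ht.
  have [[t1 xb ok _] _] := ht.
  have [xL|xL] := ltnP x'.+1 b'.
    exists (P b' x'.+2 (step_right R t) / W n), (P b' x' (step_left 1 t) / W n).
    split; [by exists b', x'.+2; split => //; exact: fresh_shape_right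
           | by exists b', x'; split |].
    rewrite !mulrA -mulrDl /P (potential_step J hp hq hR n xL ht) lerDl.
    exact: ltW.
  have Eb : b' = x'.+1 by apply/anti_leq; rewrite xL.
  subst b'.
  exists (P x'.+2 x'.+2 (step_right R t) / W n), (P x'.+1 x' (step_left 1 t) / W n).
  split; [by exists x'.+2, x'.+2; split => //; exact: fresh_shape_max
         | by exists x'.+1, x'; split |].
  rewrite !mulrA -mulrDl /P (potential_max hp hq hR hsigma n ht) mulrDl lerD2l.
  have /andP[r0 r1] := prob_right_itv hp hq t.
  have /andP[x0 x1] := exc_itv hp hq n x'.+1 x'.+1 a (step_right_ok ok).
  have /andP[t0 t1'] := gam_iter_itvW R hp hq n.
  rewrite ler_pdivrMr //.
  move: r0 r1 x0 x1 t0 t1' (w_gt0 n) Wn1.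
  move: (prob_right _ _ _) (exc _ _ _ _ _ _ _ _) (gam_iter _ _ _ _) (weight n) (W n) => r X e w V.
  move=> r0 r1 x0 x1 t0 t1' w0 V1.
  have eX : e * X <= 1 by apply: mulr_ile1 => //; exact: ltW.
  have reX : r * (e * X) <= 1.
    by apply: mulr_ile1 => //; rewrite ?mulr_ge0 // ltW.
  have -> : r * (w * e * X) = w * (r * (e * X)) by ring.
  by rewrite ler_wpM2l ?(ltW w0) //; lra.
have hP : P x x s <= d / 3 + d / 3.
  rewrite /P /potential /n big_split_ord /=; apply: lerD.
    apply: (@le_trans _ _ (\sum_(k < n0) weight k * (d / 3 / (W n0 + 1)))).
      apply: ler_sum => k _; rewrite ler_wpM2l ?(ltW (w_gt0 _)) //.
      by apply: hX0; [exact: ltnW | have [[_ _ ok _] _] := hs].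
    rewrite -mulr_suml -/(W n0) mulrCA ler_piMr ?(ltW d30) //.
    by rewrite ler_pdivrMr ?ltr_wpDl // mul1r lerDl.
  apply: le_trans (hn0 n1.+1); apply: ler_sum => k _.
  have [[_ _ ok _] _] := hs; have /andP[_ h] := exc_itv hp hq (n0 + k) x x a ok.
  by rewrite -[leRHS]mulr1 ler_wpM2l ?(ltW (w_gt0 _)).
have : P x x s / W n <= P x x s.
  rewrite ler_pdivrMr // ler_peMr //.
  by have [[_ _ ok _] _] := hs; have /andP[] := potential_itv J hp hq n x x a ok.
lra.
Qed.

(** The walk surely hits a level N' far above N, where [escape] applies; k is a time by which this
    has happened with probability above 1 - d / 2. *)
Lemma iter_mean_step_avoid1 (N : int) (s : state) (d : K) :
  (forall y, Lambda R 1 (s.2 y)) -> (forall y, N <= y -> s.2 y = sigma) ->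
  0 < d -> exists k, forall m,
    1 - d <= iter k mean (avoid (fun y => y <= N) m) s.
Proof.
move=> ok hN d0; have d20 : 0 < d / 2 by rewrite divr_gt0.
have [X0 hX0] := escape d20.
set x := (X0 + `|s.1 - N|)%N; set N' := N + x%:Z.
have ps : pristine N' s.
  split => //; first by rewrite /N' /x; lia.
  by move=> y hy; apply: hN; move: hy; rewrite /N'; lia.
set A := fun y : int => y <= N.
have supers k m t : avoid A (m + k) t <= iter k mean (avoid A m) t.
  elim: k t => [|k IH] t; first by rewrite addn0.
  rewrite addnS iterS; apply: le_trans (mean_step_le _ hp hq _ (IH)) => /=.
  case: ifP => // _; rewrite -(mean_step_cst p q R 0 t).
  by apply: mean_step_le => // u; have /andP[] := avoid_itv R hp hq A (m + k) u.
have fresh_of t : pristine N' t -> t.1 = N' -> fresh_shape R sigma N x x t.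
  move=> [okt _ h] tN; split; last by move=> j xj; apply: h; rewrite /N'; lia.
  by split => // j; lia.
(* Failure during times k to k + m requires either missing N' up to time k or coming back to N after
   hitting N'. *)
have key k m t : pristine N' t ->
    1 - (d / 2 + avoid (pred1 N') k t) <= iter k mean (avoid A m) t.
  elim: k t => [|k IH] t ht; have [tN|tN] := eqVneq t.1 N'.
  - have h := hX0 x N t (leq_addr _ _) _ m; rewrite avoid_in; last exact/eqP.
    by rewrite addr0 /=; have := h (fresh_of t ht tN); rewrite /A; lra.
  - rewrite /= (negPf tN); have /andP[h _] := avoid_itv R hp hq A m t; lra.
  - have h := hX0 x N t (leq_addr _ _) (fresh_of t ht tN) (m + k.+1)%N.
    rewrite avoid_in; last exact/eqP.
    by apply: le_trans (supers k.+1 m t); rewrite addr0 -/A; move: h; rewrite -/A; lra.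
  have [hr hl] := pristine_step ht tN.
  rewrite [avoid _ _ _]/= (negPf tN) iterS.
  pose f u := 1 - (d / 2 + avoid (pred1 N') k u).
  have -> : 1 - (d / 2 + mean (avoid (pred1 N') k) t) = mean f t.
    by rewrite /f /mean_step; ring.
  by apply: mean_step_le_at => //; exact: IH.
have ev : never (pred1 N') s = 0.
  have -> : N' = s.1 + `|N' - s.1|%N%:Z by move: ps => [_ h _]; lia.
  exact: never_up_nat.
have : \forall k \near \oo, avoid (pred1 N') k s < d / 2.
  have := @avoid_cvg _ p q R hp hq (pred1 N') s; rewrite ev => /cvgr_lt; apply.
  by [].
move=> [k _ hk]; exists k => m; apply: le_trans (key k m s ps).
have := hk k (leqnn k); rewrite /=; lra.
Qed.

End Transient.

End LongTime.

(** * Realizations of the walk *)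

Section Realization.
Variables (K : realType) (d : measure_display) (T : measurableType d).
Variables (P : probability T K) (S : nat -> T -> state).
Variables (p q : K) (R : nat) (w : env).
Hypothesis (hS : feedback_walk P p q R 1 w S).

Definition hist (n : nat) (h : nat -> state) : set T :=
  [set t | forall k, (k <= n)%N -> S k t = h k].

Definition off (A : pred int) (i m : nat) : set T :=
  [set t | forall j, (i <= j <= i + m)%N -> ~~ A (S j t).1].

Definition hist_extend (n : nat) (h : nat -> state) (s : state) : nat -> state :=
  fun k => if (k <= n)%N then h k else s.

Lemma measurable_walk_pos (n : nat) (A : pred int) : measurable [set t | A (S n t).1].
Proof.
have -> : [set t | A (S n t).1] = \bigcup_(x : int) [set t | (S n t).1 = x /\ A x].
  apply/seteqP; split => [t At|t [x _ [/= <-]]] //.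
  by exists (S n t).1.
apply: countable_bigcupT_measurable => // x.
case: (boolP (A x)) => Ax.
  have -> : [set t | (S n t).1 = x /\ true] = [set t | (S n t).1 = x].
    by apply/seteqP; split => [t [] //|t /= ->].
  exact: (walk_pos_measurable hS).
have -> : [set t | (S n t).1 = x /\ false] = set0 by apply/seteqP; split => [t []|].
exact: measurable0.
Qed.

Lemma measurable_walk_state (n : nat) (s : state) : measurable [set t | S n t = s].
Proof.
have -> : [set t | S n t = s] = ~` (~` [set t | (S n t).1 = s.1] `|`
    \bigcup_(y : int) ~` [set t | (S n t).2 y = s.2 y]).
  apply/seteqP; split => [t /= E|t /= ].
    by case=> [|[y _]]; apply; rewrite /= E.
  move=> /not_orP[/contrapT h1 h2]; rewrite [LHS]surjective_pairing [RHS]surjective_pairing h1.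
  congr (_, _); apply/funext => y; apply: contrapT => h; apply: h2.
  by exists y.
apply: measurableC; apply: measurableU; first exact/measurableC/(walk_pos_measurable hS).
by apply: countable_bigcupT_measurable => // y; exact/measurableC/(walk_env_measurable hS).
Qed.

Lemma measurable_hist n h : measurable (hist n h).
Proof.
have -> : hist n h = \bigcap_(k in [set k | (k <= n)%N]) [set t | S k t = h k].
  by apply/seteqP; split.
apply: bigcap_measurableType => k _; exact: measurable_walk_state.
Qed.

Lemma measurable_off A i m : measurable (off A i m).
Proof.
have -> : off A i m = \bigcap_(j in [set j | (i <= j <= i + m)%N]) [set t | predC A (S j t).1].
  by apply/seteqP; split.
apply: bigcap_measurableType => k _; exact: measurable_walk_pos.
Qed.

Lemma hist_extendE n h s :
  hist n.+1 (hist_extend n h s) = hist n h `&` [set t | S n.+1 t = s].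
Proof.
rewrite /hist_extend; apply/seteqP; split => [t ht|t [h1 h2] k].
  split; first by move=> k kn; have := ht k (leqW kn); rewrite kn.
  by have := ht n.+1 (leqnn _); rewrite ltnn.
by rewrite leq_eqVlt => /orP[/eqP ->|]; [rewrite ltnn | rewrite ltnS => kn; rewrite kn h1].
Qed.

Local Notation hist_right n h := (hist n.+1 (hist_extend n h (step_right R (h n)))).
Local Notation hist_left n h := (hist n.+1 (hist_extend n h (step_left 1 (h n)))).

Let finP (A : set T) : measurable A -> (P A < +oo)%E.
Proof. by move=> mA; exact: le_lt_trans (probability_le1 P mA) (ltry 1). Qed.

Lemma prob_hist_right n h :
  P (hist_right n h) = (P (hist n h) * (prob_right p q (h n))%:E)%E.
Proof. by rewrite hist_extendE -(walk_right hS). Qed.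

Lemma prob_hist_left n h :
  P (hist_left n h) = (P (hist n h) * (1 - prob_right p q (h n))%:E)%E.
Proof. by rewrite hist_extendE -(walk_left hS). Qed.

(** The two prescribed jump probabilities add up to that of the history, so any other continuation
    is a null event. *)
Lemma prob_hist_split n h (E : set T) : measurable E ->
  P (hist n h `&` E) = (P (hist_right n h `&` E) + P (hist_left n h `&` E))%E.
Proof.
move=> mE.
have mH := measurable_hist n h.
have mR : measurable (hist_right n h) by exact: measurable_hist.
have mL : measurable (hist_left n h) by exact: measurable_hist.
have RL0 : hist_right n h `&` hist_left n h = set0.
  apply/seteqP; split => // t; rewrite !hist_extendE => -[[_ /= ->] [_ /= [h1 _]]].
  by lia.
have sub : hist_right n h `|` hist_left n h `<=` hist n h.
  by rewrite !hist_extendE => t [[]|[]].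
have PU : P (hist_right n h `|` hist_left n h) = P (hist n h).
  transitivity (P (hist_right n h) + P (hist_left n h))%E; first exact: measureU.
  rewrite prob_hist_right prob_hist_left -muleDr ?fin_num_measure //.
  by rewrite -EFinD addrC subrK mule1.
have P0 : P (hist n h `\` (hist_right n h `|` hist_left n h)) = 0%E.
  transitivity (P (hist n h) - P (hist_right n h `|` hist_left n h))%E.
    by rewrite (measureD mH (measurableU _ _ mR mL) (finP mH)) setIC (setIidl sub).
  by rewrite PU subee // fin_num_measure.
have E0 : hist n h `&` E `\` (hist_right n h `|` hist_left n h) `<=`
    hist n h `\` (hist_right n h `|` hist_left n h) by move=> t [[]].
have mEH : measurable (hist n h `&` E) by exact: measurableI.
rewrite (measureDI P mEH (measurableU _ _ mR mL)).
rewrite (subset_measure0 _ _ E0 P0) ?add0e; last 2 first.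
- by apply: measurableD => //; exact: measurableU.
- by apply: measurableD => //; exact: measurableU.
have -> : hist n h `&` E `&` (hist_right n h `|` hist_left n h) =
    (hist_right n h `|` hist_left n h) `&` E.
  by apply/seteqP; split => t [] => [[_ Et]|] ht => [//|Et]; split => //; split => //; exact: sub.
rewrite setIUl measureU //; [exact: measurableI|exact: measurableI|].
by rewrite setIACA RL0 set0I.
Qed.

Lemma prob_hist_off (A : pred int) m n h :
  P (hist n h `&` off A n m) = (P (hist n h) * (avoid p q R A m (h n))%:E)%E.
Proof.
elim: m n h => [|m IH] n h.
  rewrite /=; case: (boolP (A (h n).1)) => Ah.
    rewrite mule0 (_ : _ `&` _ = set0) ?measure0 //.
    apply/seteqP; split => // t [/(_ n (leqnn n)) E /(_ n)].
    by rewrite leqnn addn0 leqnn E Ah => /(_ isT).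
  rewrite mule1; congr (P _); apply/seteqP; split => [t []//|t ht]; split => //.
  move=> j; rewrite addn0 => /anti_leq <-.
  by rewrite ht.
rewrite /=; case: (boolP (A (h n).1)) => Ah.
  rewrite mule0 (_ : _ `&` _ = set0) ?measure0 //.
  apply/seteqP; split => // t [/(_ n (leqnn n)) E /(_ n)].
  by rewrite leqnn leq_addr E Ah => /(_ isT).
have offE s : hist n.+1 (hist_extend n h s) `&` off A n m.+1 =
    hist n.+1 (hist_extend n h s) `&` off A n.+1 m.
  rewrite hist_extendE; apply/seteqP; split => t [[h1 h2] ho]; split => //.
    by move=> j jn; apply: ho; lia.
  move=> j /andP[]; rewrite leq_eqVlt => /orP[/eqP <- _|nj jm]; first by rewrite h1.
  by apply: ho; lia.
rewrite prob_hist_split; last exact: measurable_off.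
rewrite !offE !IH prob_hist_right prob_hist_left /hist_extend !ltnn.
rewrite -!muleA -!EFinM -muleDr ?fin_num_measure -?EFinD //.
exact: measurable_hist.
Qed.

Lemma prob_hist_off_iter (A : pred int) k m n h :
  P (hist n h `&` off A (n + k) m) =
  (P (hist n h) * (iter k (mean_step p q R) (avoid p q R A m) (h n))%:E)%E.
Proof.
elim: k n h => [|k IH] n h; first by rewrite addn0 prob_hist_off.
rewrite prob_hist_split; last exact: measurable_off.
rewrite -addSnnS !IH prob_hist_right prob_hist_left /hist_extend !ltnn.
rewrite -!muleA -!EFinM -muleDr ?fin_num_measure -?EFinD //.
exact: measurable_hist.
Qed.

Lemma prob_off (A : pred int) k m :
  P (off A k m) = (iter k (mean_step p q R) (avoid p q R A m) (0, w))%:E.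
Proof.
have H1 : P (hist 0 (fun=> (0, w))) = 1%E.
  rewrite -(walk_init hS); congr (P _); apply/seteqP; split => t /=; first exact.
  by move=> h j; rewrite leqn0 => /eqP ->.
have mH := measurable_hist 0 (fun=> (0, w)).
have mO := measurable_off A k m.
have := prob_hist_off_iter A k m 0 (fun=> (0, w)); rewrite H1 mul1e add0n => <-.
rewrite (measureDI P mO mH) setIC [X in (X + _)%E](_ : _ = 0%E) ?add0e //.
have HC : P (~` hist 0 (fun=> (0, w))) = 0%E.
  by rewrite probability_setC // H1 subee.
apply: (subset_measure0 _ _ _ HC); [exact: measurableD | exact: measurableC | by move=> t []].
Qed.

(** The iterate is the probability of missing 0 at times k to k + m, and a path with finitely many
    visits misses 0 from some k on. *)
Lemma as_recurrent_of :
  (forall k, iter k (mean_step p q R) (avoid p q R (pred1 0) m) (0, w)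
     @[m --> \oo] --> (0 : K)) ->
  as_recurrent P S.
Proof.
move=> h; apply: (@negligibleS _ _ _ _ (\bigcup_k \bigcap_m off (pred1 0) k m)).
  move=> t /= /contrapT/finite_seqP[s hs].
  exists (\max_(i <- s) i).+1 => // m _ j /andP[sj _]; apply/negP => /eqP Sj.
  have : j \in s.
    by have : [set n | (S n t).1 = 0] j by []; rewrite hs.
  by move=> js; move: sj; rewrite ltnNge (@leq_bigmax_seq _ s xpredT id j js isT).
apply: negligible_bigcup => k.
have mI : measurable (\bigcap_m off (pred1 0) k m).
  by apply: bigcapT_measurable => m; exact: measurable_off.
exists (\bigcap_m off (pred1 0) k m); split => //.
apply/eqP; rewrite eq_le measure_ge0 andbT.
apply/lee_addgt0Pr => e e0; rewrite add0e.
have [m _ hm] : \forall m \near \oo,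
   iter k (mean_step p q R) (avoid p q R (pred1 0) m) (0, w) < e.
  by have := h k => /cvgr_lt; apply.
apply: (@le_trans _ _ (P (off (pred1 0) k m))).
  apply: le_measure; rewrite ?inE //; first exact: measurable_off.
  exact: bigcap_inf.
by rewrite prob_off lee_fin ltW // hm /=.
Qed.

Lemma as_transient_of :
  (forall M : nat, exists2 N : int, M%:Z <= N & forall e : K, 0 < e -> exists k, forall m,
    1 - e <= iter k (mean_step p q R) (avoid p q R (fun y => y <= N) m) (0, w)) ->
  as_transient_pinfty P S.
Proof.
move=> h; apply: (@negligibleS _ _ _ _ (\bigcup_(M : nat) \bigcap_k \bigcup_m
    ~` off (fun y => y <= M%:Z) k m)).
  move=> t /= ht; apply: contrapT => hB; apply: ht.
  apply/cvgryPge => A.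
  have [M hM] : exists M : nat, A <= M%:R.
    by exists (Num.truncn `|A|).+1; apply/ltW/(le_lt_trans (ler_norm A))/truncnS_gt.
  have [k hk] : exists k, forall m, off (fun y => y <= M%:Z) k m t.
    apply: contrapT => /forallNP hk; apply: hB; exists M => // k _.
    by have /existsNP[m hm] := hk k; exists m.
  exists k => // n /= kn; apply: (le_trans hM).
  have /(_ n) := hk (n - k)%N; rewrite kn subnKC // leqnn => /(_ isT).
  by rewrite -ltNge => /ltW; rewrite -(ler_int K).
apply: negligible_bigcup => M.
have mU k : measurable (\bigcup_m ~` off (fun y => y <= M%:Z) k m).
  by apply: bigcupT_measurable => m; apply: measurableC; exact: measurable_off.
have mI : measurable (\bigcap_k \bigcup_m ~` off (fun y => y <= M%:Z) k m).
  exact: bigcapT_measurable.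
eexists; split; [exact: mI | | exact: subset_refl].
have [N MN hN] := h M.
apply/eqP; rewrite eq_le measure_ge0 andbT.
apply/lee_addgt0Pr => e e0; rewrite add0e.
have [k hk] := hN e e0.
apply: (@le_trans _ _ (P (\bigcup_m ~` off (fun y => y <= M%:Z) k m))).
  by apply: le_measure; rewrite ?inE //; exact: bigcap_inf.
rewrite -setC_bigcap probability_setC; last first.
  by apply: bigcapT_measurable => m; exact: measurable_off.
rewrite leeBlDr; last first.
  by rewrite fin_num_measure //; apply: bigcapT_measurable => m; exact: measurable_off.
rewrite -leeBlDl // -EFinB.
(* Continuity from above carries the bound, uniform in m, over to the event for all m. *)
have cv := @nonincreasing_cvg_mu _ _ _ P (off (fun y => y <= M%:Z) k)
  (finP (measurable_off _ _ _)) (fun i => measurable_off _ _ _)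
  (bigcapT_measurable (fun i => measurable_off _ _ _)).
have {}cv : P (off (fun y => y <= M%:Z) k m) @[m --> \oo] -->
    P (\bigcap_m off (fun y => y <= M%:Z) k m).
  apply: cv => m n mn; apply/subsetPset => t ht j hj; apply: ht; lia.
rewrite -(cvg_lim _ cv) //; apply: lime_ge; first by apply/cvg_ex; eexists; exact: cv.
apply: nearW => m; apply: (@le_trans _ _ (P (off (fun y => y <= N) k m))).
  by rewrite prob_off lee_fin; exact: hk.
apply: le_measure; rewrite ?inE; [exact: measurable_off|exact: measurable_off|].
by move=> t ht j hj; have := ht j hj; rewrite -!ltNge; exact: le_lt_trans.
Qed.

End Realization.

(** * Criticality and the polynomials *)

Section Criticality.
Variables (K : realType) (p q : K) (R : nat).
Hypotheses (hp : 0 < p < 1) (hq : 0 < q < 1).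
Hypothesis (halpha : alpha p q R 1 = 1 / 2).

(** For L = 1 both brackets of alpha contain the factor p; once it is cancelled, the equation is
    linear in p. *)
Lemma alpha_half : p * (1 - 2 * q + q ^+ R) = 1 - 2 * q + q ^+ R * q.
Proof.
have [p0 p1] := andP hp; have [q0 q1] := andP hq.
move: halpha; rewrite /alpha /= !expr1.
have x0 : 0 < q ^+ R by exact: exprn_gt0.
have x1 : q ^+ R <= 1 by rewrite exprn_ile1 // ltW.
move: (q ^+ R) x0 x1 => x x0 x1.
set a := (1 - q) * x * _; set b := p * (1 - p) * _ => h.
have a0 : 0 < a by rewrite /a !mulr_gt0; lra.
have b0 : 0 <= b by rewrite /b !mulr_ge0; lra.
have h2 : 2 * (p * a + q * b) = a + b.
  have -> : p * a + q * b = 1 / 2 * (a + b) by rewrite -h divfK // gt_eqF //; lra.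
  by field.
have : p * ((2 * p - 1) * (1 - q) * x + (2 * q - 1) * (1 - p) * (1 - x)) = 0.
  have -> : p * ((2 * p - 1) * (1 - q) * x + (2 * q - 1) * (1 - p) * (1 - x)) =
    2 * (p * a + q * b) - (a + b) by rewrite /a /b; ring.
  by rewrite h2 subrr.
move=> /eqP; rewrite mulf_eq0 gt_eqF //= => /eqP h3.
by apply/eqP; rewrite -subr_eq0 -[X in _ == X]h3; apply/eqP; ring.
Qed.

Lemma alpha_half_denom : 0 < 1 - 2 * q + q ^+ R.
Proof.
have [p0 p1] := andP hp; have [q0 q1] := andP hq.
have x0 : 0 < q ^+ R by exact: exprn_gt0.
have := alpha_half; move: (q ^+ R) x0 => x x0 h.
have : 0 < (1 - p) * (1 - 2 * q + x).
  have -> : (1 - p) * (1 - 2 * q + x) = x * (1 - q) by rewrite mulrBl h; ring.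
  by rewrite mulr_gt0 // subr_gt0.
by rewrite pmulr_rgt0 // subr_gt0.
Qed.

Lemma crit_p : p = (1 - 2 * q + q ^+ (R + 1)) / (1 - 2 * q + q ^+ R).
Proof.
rewrite exprD expr1 -alpha_half mulfK // gt_eqF //; exact: alpha_half_denom.
Qed.

(** The recursion m -> q (1 + m) has fixed point q / (1 - q) and multiplies the deviation from it by
    q; 1 - 2 q is (1 - q) times the deviation at j = R. The powers of q clear denominators. *)
Lemma gam_mean_closed (j : nat) : (j <= R)%N ->
  (1 - q) * gam_mean p q j * q ^+ (R - j) = q * q ^+ (R - j) + (1 - 2 * q).
Proof.
have [p0 p1] := andP hp; have [q0 q1] := andP hq.
elim: j => [_|j IH jR].
  rewrite subn0 /=; have := alpha_half; move: (q ^+ R) => x h.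
  have h2 : x * (1 - q) = (1 - p) * (1 - 2 * q + x) by rewrite mulrBl h; ring.
  have -> : (1 - q) * (p / (1 - p)) * x = (x * (1 - q)) * p / (1 - p) by ring.
  rewrite h2.
  have -> : (1 - p) * (1 - 2 * q + x) * p / (1 - p) = p * (1 - 2 * q + x).
    by field; lra.
  by rewrite h; ring.
have {}IH := IH (ltnW jR).
have E : q ^+ (R - j) = q * q ^+ (R - j.+1) by rewrite -exprS; congr (_ ^+ _); lia.
move: IH => /=; rewrite E; move: (q ^+ (R - j.+1)) (gam_mean p q j) => y m IH.
have -> : (1 - q) * (q * (1 + m)) * y = (1 - q) * m * (q * y) + (1 - q) * (q * y) by ring.
by rewrite IH; ring.
Qed.

Lemma gam_mean_crit : gam_mean p q R = 1.
Proof.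
have [q0 q1] := andP hq.
have := gam_mean_closed (leqnn R); rewrite subnn expr0 !mulr1 => h.
have : (1 - q) * (gam_mean p q R - 1) = 0 by rewrite mulrBr h; ring.
by move=> /eqP; rewrite mulf_eq0 gt_eqF ?subr_gt0 //= subr_eq0 => /eqP.
Qed.

(** Solves c_(j+1) = q (m_j + c_j) with c_0 = m_0^2, where m_j is given by [gam_mean_closed]. *)
Lemma gam_curv_closed (j : nat) : (j <= R)%N ->
  (1 - q) ^+ 2 * gam_curv p q j 1 * q ^+ (R - j) * q ^+ R =
  (q * q ^+ R + (1 - 2 * q)) ^+ 2 + q ^+ R * (j%:R * (1 - q) * (1 - 2 * q)
    + q ^+ 2 * (q ^+ (R - j) - q ^+ R)).
Proof.
have [p0 p1] := andP hp; have [q0 q1] := andP hq.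
elim: j => [_|j IH jR].
  have := gam_mean_closed (leq0n R); rewrite subn0 /= => <-.
  move: (q ^+ R) => x; field; lra.
have {}IH := IH (ltnW jR); have Em := gam_mean_closed (ltnW jR).
have E : q ^+ (R - j) = q * q ^+ (R - j.+1) by rewrite -exprS; congr (_ ^+ _); lia.
move: IH Em => /=; rewrite E mul1r -(@natr1 _ j).
move: (q ^+ (R - j.+1)) (gam_mean p q j) (gam_curv p q j 1) (q ^+ R) (j%:R) => y m c x n IH Em.
have -> : (1 - q) ^+ 2 * (q * (m + c)) * y * x =
  (1 - q) * x * ((1 - q) * m * (q * y)) + (1 - q) ^+ 2 * c * (q * y) * x by ring.
by rewrite IH Em; ring.
Qed.

Lemma Ppoly_horner (i : nat) : (i <= R)%N ->
  (Ppoly K R i).[q] =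
  q ^+ R * (1 - q) ^+ 2 * (1 + gam_curv p q R 1 - gam_mean p q (R - i)).
Proof.
move=> iR; have h1 := gam_curv_closed (leqnn R); have h2 := gam_mean_closed (leq_subr i R).
have e1 : q ^+ R = q ^+ (R - i) * q ^+ i by rewrite -exprD subnK.
have e2 : (R + 2 - i = (R - i) + 2)%N by lia.
have e3 : (R + 1 - i = (R - i) + 1)%N by lia.
move: h1 h2; rewrite subnn expr0 mulr1 subKn // => h1 h2.
have -> : q ^+ R * (1 - q) ^+ 2 * (1 + gam_curv p q R 1 - gam_mean p q (R - i)) =
  q ^+ R * (1 - q) ^+ 2 + (1 - q) ^+ 2 * gam_curv p q R 1 * q ^+ R
  - (1 - q) * q ^+ (R - i) * ((1 - q) * gam_mean p q (R - i) * q ^+ i).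
  by rewrite e1; ring.
rewrite h1 h2.
have -> : (1 - q) * q ^+ (R - i) * (q * q ^+ i + (1 - 2 * q)) =
  (1 - q) * (q * q ^+ R + q ^+ (R - i) * (1 - 2 * q)) by rewrite e1; ring.
have -> : (Ppoly K R i).[q] = (2 * R%:R - 1) * q ^+ (R + 2)
    - (3 * R%:R + 1) * q ^+ (R + 1) + (R%:R + 1) * q ^+ R
    - 2 * q ^+ (R + 2 - i) + 3 * q ^+ (R + 1 - i) - q ^+ (R - i)
    + (1 - 2 * q) ^+ 2.
  by rewrite /Ppoly !hornerE.
rewrite e2 e3 !exprD; ring.
Qed.

End Criticality.

(** * The root of P_{R,R} *)

Section CriticalRoot.
Variable K : realType.

(** P_{R,R} divided by X, for R = m + 1. *)
Definition root_factor (m : nat) : {poly K} :=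
  'X^m * ((2 * m.+1%:R - 1) *: 'X^2 - (3 * m.+1%:R + 1) *: 'X + (m.+1%:R + 1)%:P)
  + 2 *: 'X - 1.

Lemma root_factorE (m : nat) (x : K) : (root_factor m).[x] =
  x ^+ m * (m.+1%:R * ((1 - 2 * x) * (1 - x)) + (1 - x - x ^+ 2)) - (1 - 2 * x).
Proof.
have -> : (root_factor m).[x] = x ^+ m * ((2 * m.+1%:R - 1) * x ^+ 2
    - (3 * m.+1%:R + 1) * x + (m.+1%:R + 1)) + 2 * x - 1.
  by rewrite /root_factor hornerD hornerN hornerD hornerM !hornerE.
ring.
Qed.

Lemma PpolyRR_horner (m : nat) (x : K) :
  (PpolyRR K m.+1).[x] = x * (root_factor m).[x].
Proof.
have -> : (PpolyRR K m.+1).[x] = (2 * m.+1%:R - 1) * x ^+ (m.+1 + 2)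
    - (3 * m.+1%:R + 1) * x ^+ (m.+1 + 1) + (m.+1%:R + 1) * x ^+ m.+1
    + 2 * x ^+ 2 - x.
  by rewrite /PpolyRR !hornerE.
rewrite root_factorE !exprD exprS; ring.
Qed.

(* On (0, 1/2) the sign of the factor is that of y^m B(y) / (1 - 2 y) - 1, where
   B(y) / (1 - 2 y) = (m + 1) (1 - y) + (1 - y - y^2) / (1 - 2 y), and both
   y^m (1 - y) and (1 - y - y^2) / (1 - 2 y) increase. *)
Lemma root_factor_mono (m : nat) (x y : K) : (0 < m)%N -> 0 < x -> x < y -> y <= 1 / 2 ->
  0 <= (root_factor m).[x] -> 0 < (root_factor m).[y].
Proof.
case: m => // m _ x0 xy y2; rewrite !root_factorE !exprS.
have xym : x ^+ m <= y ^+ m by apply: lerXn2r; rewrite ?nnegrE; lra.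
have xm0 : 0 < x ^+ m by exact: exprn_gt0.
move: (x ^+ m) (y ^+ m) xym xm0 => X Y XY X0; set k := m.+2%:R.
have k0 : 0 <= k by exact: ler0n.
move=> hx.
have ux : 0 < 1 - x - x ^+ 2 by nra.
have uy : 0 < 1 - y - y ^+ 2 by nra.
have q1 : x * (1 - x) <= y * (1 - y) by nra.
have Y0 : 0 < Y by lra.
have XYq : X * (x * (1 - x)) <= Y * (y * (1 - y)).
  by apply: ler_pM => //; [exact: ltW | nra].
have cross : (1 - 2 * y) * (1 - x - x ^+ 2) < (1 - 2 * x) * (1 - y - y ^+ 2).
  have -> : (1 - 2 * x) * (1 - y - y ^+ 2) =
    (1 - 2 * y) * (1 - x - x ^+ 2) + (y - x) * (1 - x - y + 2 * x * y) by ring.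
  by rewrite ltrDl mulr_gt0 //; nra.
have XYl : x * X <= y * Y by apply: ler_pM; lra.
have xX0 : 0 < x * X by rewrite mulr_gt0.
set Fx := x * X * _ - _ in hx.
(* Cross-multiplication replaces the quotient by 1 - 2 y, which vanishes at y = 1/2. *)
suff : 0 < (1 - 2 * x) * (y * Y * (k * ((1 - 2 * y) * (1 - y)) + (1 - y - y ^+ 2)) - (1 - 2 * y)).
  by rewrite pmulr_rgt0 //; lra.
have -> : (1 - 2 * x) * (y * Y * (k * ((1 - 2 * y) * (1 - y)) + (1 - y - y ^+ 2)) - (1 - 2 * y))
  = (1 - 2 * y) * Fx
  + k * ((1 - 2 * x) * (1 - 2 * y)) * (Y * (y * (1 - y)) - X * (x * (1 - x)))
  + (y * Y - x * X) * ((1 - 2 * x) * (1 - y - y ^+ 2))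
  + x * X * ((1 - 2 * x) * (1 - y - y ^+ 2) - (1 - 2 * y) * (1 - x - x ^+ 2)).
  by rewrite /Fx; ring.
apply: ltr_wpDl; last by rewrite mulr_gt0 // subr_gt0.
apply: addr_ge0; last first.
  apply: mulr_ge0; first by rewrite subr_ge0.
  by apply: mulr_ge0; [lra | exact: ltW].
apply: addr_ge0; first by apply: mulr_ge0 => //; lra.
apply: mulr_ge0; last by rewrite subr_ge0.
by apply: mulr_ge0 => //; apply: mulr_ge0; lra.
Qed.

(** The geometric sum of x^i for i <= m is at least (m + 1) x^m; what remains is at least x^m (1 -
    x)^2. *)
Lemma root_factor_gt0 (m : nat) (x : K) : 1 / 2 <= x < 1 -> 0 < (root_factor m).[x].
Proof.
move=> /andP[x2 x1]; rewrite root_factorE.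
have x0 : 0 < x by lra.
have xm0 : 0 < x ^+ m by exact: exprn_gt0.
have geom : m.+1%:R * (1 - x) * x ^+ m <= 1 - x * x ^+ m.
  have xm1 : x ^+ m <= 1 by rewrite exprn_ile1 // ltW.
  rewrite -exprS -[leRHS]opprB subrX1 -mulNr opprB mulrAC mulrC ler_pM2l ?subr_gt0 //.
  rewrite mulr_natl -[X in _ *+ X](card_ord m.+1) -sumr_const.
  by apply: ler_sum => i _; apply: ler_wiXn2l; [exact: ltW | exact: ltW | rewrite -ltnS].
have h1 : (2 * x - 1) * (m.+1%:R * (1 - x) * x ^+ m) <= (2 * x - 1) * (1 - x * x ^+ m).
  by rewrite ler_wpM2l //; lra.
have h2 : 0 < x ^+ m * (1 - x) ^+ 2 by rewrite mulr_gt0 // exprn_gt0 // subr_gt0.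
move: h1 h2; move: (x ^+ m) (m.+1%:R) => X k h1 h2.
have -> : X * (k * ((1 - 2 * x) * (1 - x)) + (1 - x - x ^+ 2)) - (1 - 2 * x) =
  (2 * x - 1) * (1 - x * X) - (2 * x - 1) * (k * (1 - x) * X) + X * (1 - x) ^+ 2 by ring.
lra.
Qed.

Lemma root_factor_root (m : nat) : (0 < m)%N ->
  exists2 r : K, 0 < r < 1 / 2 & (root_factor m).[r] = 0.
Proof.
move=> m0.
have F0 : (root_factor m).[0] = -1.
  by rewrite root_factorE expr0n gtn_eqF // mul0r; ring.
have F2 : 0 < (root_factor m).[1 / 2] by apply: root_factor_gt0; lra.
have /(poly_ivt _)[] : (root_factor m).[0] <= 0 <= (root_factor m).[1 / 2].
  by rewrite F0 (ltW F2) lerN10.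
  by lra.
move=> r /andP[r0' r2'] /rootP rr; exists r => //.
have r0 : r != 0 by apply: contra_eq_neq rr => ->; rewrite F0 oppr_eq0 oner_eq0.
have r2 : r != 1 / 2 by apply: contra_eq_neq rr => ->; rewrite gt_eqF.
by rewrite !lt_neqAle r2 eq_sym r0 r0' r2'.
Qed.

(** At a root, 1 - 2 r is r^m times a factor of at most m + 2, and r^m is at most 2^(-m). *)
Lemma root_factor_root_ge (m : nat) (r : K) : 0 < r < 1 / 2 ->
  (root_factor m).[r] = 0 -> 1 / 2 - r <= (m.+2%:R) / 2 ^+ m.+1.
Proof.
move=> /andP[r0 r2]; rewrite root_factorE => /eqP; rewrite subr_eq0 => /eqP h.
have rm0 : 0 < r ^+ m by exact: exprn_gt0.
have rm : r ^+ m <= (1 / 2) ^+ m by apply: lerXn2r; rewrite ?nnegrE; lra.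
have k0 : 0 <= m.+1%:R :> K by exact: ler0n.
have B : m.+1%:R * ((1 - 2 * r) * (1 - r)) + (1 - r - r ^+ 2) <= m.+2%:R.
  rewrite -(@natr1 _ m.+1); apply: lerD; last by nra.
  by rewrite ler_piMr //; nra.
have B0 : 0 <= m.+1%:R * ((1 - 2 * r) * (1 - r)) + (1 - r - r ^+ 2).
  by rewrite addr_ge0 ?mulr_ge0 //; nra.
have : 1 - 2 * r <= (1 / 2) ^+ m * m.+2%:R by rewrite -h ler_pM // ltW.
rewrite expr_div_n expr1n div1r exprS invfM.
move: (_^-1) (m.+2%:R) => z k; lra.
Qed.

Lemma natr_div_exp2_cvg0 : (n.+1%:R / 2 ^+ n : K) @[n --> \oo] --> (0 : K).
Proof.
(* This dominates the sequence by 4 / (n + 1). The induction step holds from n = 2 on; smaller cases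
   are computed. *)
have bnd n : (n.+1 ^ 2 <= 4 * 2 ^ n)%N.
  elim: n => // -[|[|n]] // IH.
  rewrite [(2 ^ n.+3)%N]expnS mulnCA; apply: leq_trans (leq_mul (leqnn 2) IH).
  by rewrite !expnS !expn0; nia.
apply: (@squeeze_cvgr _ _ _ _ (fun=> 0) (fun n => 4 * harmonic n)).
- apply: nearW => n; rewrite divr_ge0 ?exprn_ge0 //=.
  rewrite /harmonic ler_pdivlMr // mulrAC ler_pdivrMr ?exprn_gt0 //.
  by rewrite -expr2 -!natrX -natrM ler_nat.
- exact: cvg_cst.
- by rewrite -[X in _ --> X](mulr0 4); apply: cvgMr; exact: cvg_harmonic.
Qed.

Lemma critical_root : exists qstar : nat -> K,
    (forall R : nat, (2 <= R)%N ->
      [/\ 0 < qstar R < 1 / 2,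
          root (PpolyRR K R) (qstar R),
          forall q : K, 0 < q < 1 / 2 -> root (PpolyRR K R) q -> q = qstar R
        & forall q : K, 0 < q < 1 ->
            (qstar R < q -> 0 < (PpolyRR K R).[q]) /\
            (q < qstar R -> (PpolyRR K R).[q] < 0)]) /\
    qstar n @[n --> \oo] --> (1 / 2 : K).
Proof.
have ex (R : nat) : exists r : K, (2 <= R)%N -> 0 < r < 1 / 2 /\ (root_factor R.-1).[r] = 0.
  case: R => [|[|m]]; [by exists 0 | by exists 0 |].
  by have [r] := @root_factor_root m.+1 isT; exists r.
have [qstar hq] := choice ex.
exists qstar; split.
  case=> [//|m] m2; have [r2 r0] := hq m.+1 m2; have /andP[r0' r2'] := r2.
  have m0 : (0 < m)%N by [].
  have neg x : 0 < x -> x < qstar m.+1 -> (root_factor m).[x] < 0.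
    move=> x0 xr; rewrite ltNge; apply/negP => h.
    by have := root_factor_mono m0 x0 xr (ltW r2') h; rewrite r0 ltxx.
  have pos x : qstar m.+1 < x -> x < 1 -> 0 < (root_factor m).[x].
    move=> rx x1; have [x2|x2] := leP x (1 / 2).
      by apply: (root_factor_mono m0 r0' rx x2); rewrite r0.
    by apply: root_factor_gt0; lra.
  split => //.
  - by apply/rootP; rewrite PpolyRR_horner r0 mulr0.
  - move=> x /andP[x0 x2] /rootP; rewrite PpolyRR_horner => /eqP.
    rewrite mulf_eq0 gt_eqF //= => /eqP hx.
    have x1 : x < 1 by lra.
    case: (ltgtP x (qstar m.+1)) => // h.
    + by have := neg x x0 h; rewrite hx ltxx.
    + by have := pos x h x1; rewrite hx ltxx.
  - move=> x /andP[x0 x1]; rewrite PpolyRR_horner; split => h.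
    + by rewrite mulr_gt0 // pos.
    + by rewrite pmulr_rlt0 // neg.
apply: (@squeeze_cvgr _ _ _ _ (fun n => 1 / 2 - n.+1%:R / 2 ^+ n) (fun=> 1 / 2)).
- near=> n; have n2 : (2 <= n)%N by near: n; exists 2%N.
  have [/andP[r0 r2] rr] := hq n n2; rewrite (ltW r2) andbT.
  have := @root_factor_root_ge n.-1 (qstar n); rewrite r0 r2 prednK; last by lia.
  by move=> /(_ isT rr); lra.
- rewrite -[X in _ --> X]subr0; apply: cvgB; [exact: cvg_cst | exact: natr_div_exp2_cvg0].
- exact: cvg_cst.
Unshelve. all: by end_near.
Qed.

End CriticalRoot.

(** * Recurrence or transience from the sign of P_{R,i}(q) *)

Section Dichotomy.
Variables (K : realType) (p q : K) (R : nat) (w : env).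
Hypotheses (hp : 0 < p < 1) (hq : 0 < q < 1) (hR : (2 <= R)%N).
Hypotheses (halpha : alpha p q R 1 = 1 / 2) (hw : forall x, Lambda R 1 (w x)).
Variables (d : measure_display) (T : measurableType d).
Variables (P : probability T K) (S : nat -> T -> state).
Hypothesis (hS : feedback_walk P p q R 1 w S).

Let R_gt0 : (0 < R)%N. Proof. exact: ltnW. Qed.

Lemma recurrent_criterion (sigma : label) (J : nat) :
  label_gam p q R sigma = gam p q J -> gam_mean p q J <= 1 + gam_curv p q R 1 ->
  near_pinfty (fun x => w x = sigma) -> as_recurrent P S.
Proof.
move=> hsigma hJ [N hN]; apply: (as_recurrent_of hS) => k.
apply: (@iter_mean_step_avoid0 _ _ _ _ J sigma R_gt0 hp hq _ hsigma hJ `|N|%N).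
  exact: gam_mean_crit halpha.
split => //; exists `|N|%N%:Z; split => //=; first by lia.
by move=> y hy; apply: hN; lia.
Qed.

Lemma transient_criterion (sigma : label) (J : nat) :
  label_gam p q R sigma = gam p q J -> 1 + gam_curv p q R 1 < gam_mean p q J ->
  near_pinfty (fun x => w x = sigma) -> as_transient_pinfty P S.
Proof.
move=> hsigma hJ [N hN]; apply: (as_transient_of hS) => M.
exists (Num.max M%:Z N); first by rewrite le_max lexx.
move=> e e0.
apply: (@iter_mean_step_avoid1 _ _ _ _ J sigma R_gt0 hp hq _ hsigma hJ) => //.
  exact: gam_mean_crit halpha.
by move=> y; rewrite ge_max => /andP[_ hy]; exact: hN.
Qed.

Lemma Ppoly_criterion (i : nat) (sigma : label) : (i <= R)%N ->
  label_gam p q R sigma = gam p q (R - i) -> near_pinfty (fun x => w x = sigma) ->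
  (0 <= (Ppoly K R i).[q] -> as_recurrent P S) /\
  ((Ppoly K R i).[q] < 0 -> as_transient_pinfty P S).
Proof.
move=> iR hsigma hN; have [q0 q1] := andP hq.
have c0 : 0 < q ^+ R * (1 - q) ^+ 2 by rewrite mulr_gt0 ?exprn_gt0 ?subr_gt0.
rewrite (Ppoly_horner hp hq halpha iR) pmulr_rge0 // pmulr_rlt0 // subr_ge0 subr_lt0.
by split => h; [exact: (recurrent_criterion hsigma h hN) | exact: (transient_criterion hsigma h hN)].
Qed.

End Dichotomy.
Unset Implicit Arguments.

Theorem theorem7 (K : realType) :
  (forall (p q : K) (R : nat) (w : env),
    0 < p < 1 -> 0 < q < 1 -> (2 <= R)%N ->
    alpha p q R 1 = 1 / 2 ->
    (forall x, Lambda R 1 (w x)) ->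
    (p < q -> exists s : label, near_ninfty (fun x => w x = s)) ->
    p = (1 - 2 * q + q ^+ (R + 1)) / (1 - 2 * q + q ^+ R) /\
    (forall (d : measure_display) (T : measurableType d)
        (P : probability T K) (S : nat -> T -> state),
      feedback_walk P p q R 1 w S ->
      [/\ (* (i) *)
          near_pinfty (fun x => w x = Lq 0) -> as_recurrent P S,
          (* (ii) *)
          forall i : nat, (1 <= i <= R - 1)%N ->
            near_pinfty (fun x => w x = Lq i) ->
            (0 <= (Ppoly K R i).[q] -> as_recurrent P S) /\
            ((Ppoly K R i).[q] < 0 -> as_transient_pinfty P S)
        & (* (iii) *)
          near_pinfty (fun x => w x = Lp 0) ->
            (0 <= (PpolyRR K R).[q] -> as_recurrent P S) /\
            ((PpolyRR K R).[q] < 0 -> as_transient_pinfty P S)])) /\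
  (exists qstar : nat -> K,
    (forall R : nat, (2 <= R)%N ->
      [/\ 0 < qstar R < 1 / 2,
          root (PpolyRR K R) (qstar R),
          forall q : K, 0 < q < 1 / 2 -> root (PpolyRR K R) q -> q = qstar R
        & forall q : K, 0 < q < 1 ->
            (qstar R < q -> 0 < (PpolyRR K R).[q]) /\
            (q < qstar R -> (PpolyRR K R).[q] < 0)]) /\
    qstar n @[n --> \oo] --> (1 / 2 : K)).
Proof.
split; last exact: critical_root.
move=> p q R w hp hq hR halpha hw _; split; first exact: crit_p.
move=> d T P S hS; split.
(* With (q,0) the first individual is typical: its mean is 1, below the threshold. *)
- apply: (recurrent_criterion hp hq hR halpha hw hS (J := R)); first by rewrite /= subn0.
  rewrite (gam_mean_crit hp hq halpha) lerDl ltW // gam_curv_gt0 //.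
  by rewrite ler01 lexx.
- move=> i hi; apply: (Ppoly_criterion hp hq hR halpha hw hS) => //; lia.
(* The label (p,0) takes the place of (q,R), so this is the case i = R. *)
- rewrite -Ppoly_diag; apply: (Ppoly_criterion hp hq hR halpha hw hS) => //.
  by rewrite subnn.
Qed.
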